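(* Let $X:[0,T]\to\mathbb R^d$ be a path of bounded variation, let $p\ge1$ and $\kappa=\lfloor p\rfloor$. Then for every non-empty word $I=i_1\cdots i_n$ over $\{1,\dots,d\}$ with $n\le\kappa-1$, $$K^{(I)}=\sum_{\pi\in NC(n)}\Big(\prod_{(a,b)\in P(\pi)}(-1)\,\delta_{i_a,i_b}\Big)K_{i_{U_1},\dots,i_{U_r}},$$ with the convention $K^{(\emptyset)}=K_\emptyset=K$, where $U(\pi)=\{U_1<\cdots<U_r\}$ and, for a non-empty word $J=j_1\cdots j_m$, $$K_J(s,t)=(-1)^m\int_{s<u_1<\cdots<u_m<t}K(s,u_1)K(u_1,u_2)\cdots K(u_{m-1},u_m)K(u_m,t)\,dX^{(j_1)}_{u_1}\cdots dX^{(j_m)}_{u_m}.$$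
   Context: $S(X)_{s,t}$ is the signature (sequence of iterated Riemann–Stieltjes integrals) of $X$ on $[s,t]$ and $S^{(L)}(X)_{s,t}=\int_{s<u_1<\cdots<u_n<t}dX^{(l_1)}_{u_1}\cdots dX^{(l_n)}_{u_n}$ for a word $L=l_1\cdots l_n$. $\varphi(l_1\cdots l_n)$ is the joint moment of $d$ free standard semicircular variables (the number of non-crossing pair partitions of $\{1,\dots,n\}$ pairing only equal letters; $\varphi(\emptyset)=1$). The Schwinger–Dyson kernel is $K(s,t)=\sum_Li^{|L|}\varphi(L)S^{(L)}(X)_{s,t}$, $0\le s\le t\le T$, sum over all words, $i=\sqrt{-1}$. $K^{(I)}$ denotes the higher components of $K$ viewed as a controlled path in the second variable $t$, indexed so that $K^{(Ij)}$ is the coefficient of $dX^{(j)}_t$ in the differential of $K^{(I)}$ in $t$; explicitly, for $I=i_1\cdots i_n$, $$K^{(I)}(s,t)=\sum_Li^{|L|+n}\varphi(L\,i_n i_{n-1}\cdots i_1)\,S^{(L)}(X)_{s,t}.$$ $NC(n)$ is the set of partial matchings of $\{1,\dots,n\}$ (partitions into pairs and singletons) defined recursively by $NC(1)=\{\{\{1\}\}\}$ and $$NC(n)=\{\pi\cup\{\{n\}\}:\pi\in NC(n-1)\}\cup\{(\pi\setminus\{\{m\}\})\cup\{\{m,n\}\}:\pi\in NC(n-1),\ m=\max U(\pi)\},$$ where $U(\pi)$ is the set of unmatched elements (singletons) of $\pi$ and $P(\pi)$ its set of pairs; when $U(\pi)=\emptyset$ the second construction contributes nothing. *)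

(* Defs.v *)
From HB Require Import structures.
From mathcomp Require Import all_boot all_order all_algebra.
From mathcomp Require Import finmap.
From mathcomp Require Import all_classical all_reals all_analysis.
From mathcomp Require Import complex.

Set Implicit Arguments.
Unset Strict Implicit.
Unset Printing Implicit Defensive.

Import Order.TTheory GRing.Theory Num.Theory.
Import numFieldNormedType.Exports.

Local Open Scope ring_scope.

Section Matchings.
Local Open Scope fset_scope.

(* A partial matching of {1, ..., n} is the finite set of its blocks, each of
   which is a singleton or a pair of natural numbers. *)
Definition matching := {fset {fset nat}}.

Definition unmatched (n : nat) (pi : matching) : seq nat :=
  [seq m <- iota 1 n | [fset m] \in pi].

Definition matched_pairs (n : nat) (pi : matching) : seq (nat * nat) :=
  [seq ab <- [seq (a, b) | a <- iota 1 n, b <- iota 1 n]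
     | (ab.1 < ab.2)%N && ([fset ab.1; ab.2] \in pi)].

(* The recursion starts at n = 0 with the empty matching; its first step yields
   NC 1 = {{{1}}} (lemma NC1). As unmatched is increasing, its last element is
   the maximum of the unmatched points. *)
Fixpoint NC (n : nat) : {fset matching} :=
  if n is m.+1 then
    [fset pi `|` [fset [fset m.+1]] | pi in NC m] `|`
    [fset (pi `\ [fset last 0%N (unmatched m pi)])
            `|` [fset [fset last 0%N (unmatched m pi); m.+1]]
        | pi in NC m & unmatched m pi != [::]]
  else [fset fset0].

Lemma NC1 : NC 1 = [fset [fset [fset 1%N]]].
Proof.
apply/fsetP => x; rewrite /= !inE; apply/orP/eqP => [[]|->].
- by case/imfsetP => pi /=; rewrite inE => /eqP -> ->; rewrite fset0U.
- by case/imfsetP => pi /=; rewrite !inE => /andP[_ /eqP].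
- by left; apply/imfsetP; exists fset0; rewrite ?inE //= fset0U.
Qed.

End Matchings.

Section Semicircular.
Variable d : nat.

Definition noncrossing n (P : {set {set 'I_n}}) : bool :=
  [forall a : 'I_n, forall b : 'I_n, forall c : 'I_n, forall e : 'I_n,
     [&& (a < b)%N, (b < c)%N, (c < e)%N & ([set a; c]%SET \in P)]
       ==> ([set b; e]%SET \notin P)].

(* phi L is the joint moment of free standard semicircular variables along the
   word L. *)
Definition nc_pairings (L : seq 'I_d) : {set {set {set 'I_(size L)}}} :=
  [set P : {set {set 'I_(size L)}} |
     [&& finset.partition P [set: 'I_(size L)]%SET,
         [forall B in P, #|B| == 2%N],
         [forall a : 'I_(size L), forall b : 'I_(size L),
            ([set a; b]%SET \in P)
              ==> (tnth (in_tuple L) a == tnth (in_tuple L) b)]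
       & noncrossing P]]%SET.

Definition phi (L : seq 'I_d) : nat := #|nc_pairings L|.

End Semicircular.

Section SchwingerDyson.
Variable R : realType.

(* Riemann-Stieltjes integral of f against the real integrator g over [a, b],
   as the limit of tagged sums when the mesh tends to 0. The points of the
   partition are a :: s, and z k is the tag in its k-th interval. *)
Definition RS_sum (f : R -> R[i]) (g : R -> R) (a : R) (s : seq R)
    (z : nat -> R) : R[i] :=
  \sum_(k < size s)
    (g (nth 0 (a :: s) k.+1) - g (nth 0 (a :: s) k))%:C%C * f (z k).

Definition is_RS_int (f : R -> R[i]) (g : R -> R) (a b : R) (v : R[i]) : Prop :=
  forall e : R, 0 < e -> exists2 delta : R, 0 < delta &
    forall (s : seq R) (z : nat -> R), itv_partition a b s ->
      (forall k, (k < size s)%N ->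
         nth 0 (a :: s) k.+1 - nth 0 (a :: s) k < delta /\
         nth 0 (a :: s) k <= z k <= nth 0 (a :: s) k.+1) ->
      `|RS_sum f g a s z - v| < e%:C%C.

(* 0 when the integral does not exist. *)
Definition RS_int (f : R -> R[i]) (g : R -> R) (a b : R) : R[i] :=
  xget 0 (is_RS_int f g a b).

Definition path_bounded_variation (d : nat) (a b : R) (X : R -> 'rV[R]_d) :=
  has_ubound [set v : R | exists2 s : seq R, itv_partition a b s &
    v = \sum_(k < size s) `|X (nth 0 (a :: s) k.+1) - X (nth 0 (a :: s) k)|]%classic.

Section Path.
Variables (d : nat) (X : R -> 'rV[R]_d).

Definition coord (j : 'I_d) : R -> R := fun u => X u 0 j.

Fixpoint iter_int_rev (J : seq 'I_d) (F : seq R -> R[i]) (s t : R) : R[i] :=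
  if J is j :: J' then
    RS_int (fun u => iter_int_rev J' (fun us => F (rcons us u)) s u)
           (coord j) s t
  else F [::].

(* For J = j_1 ... j_m,
     iter_int J F s t
       = int_{s < u_1 < ... < u_m < t} F(u_1, ..., u_m)
           dX^{(j_1)}_{u_1} ... dX^{(j_m)}_{u_m},
   with u_m outermost; the recursion is on the last letter. *)
Definition iter_int (J : seq 'I_d) (F : seq R -> R[i]) (s t : R) : R[i] :=
  iter_int_rev (rev J) F s t.

Definition signature (L : seq 'I_d) (s t : R) : R[i] :=
  iter_int L (fun=> 1) s t.

(* Sum over all words, grouped by length. For the signature of a path of bounded
   variation the sums below converge absolutely, so the order is immaterial. *)
Definition word_sum (a : seq 'I_d -> R[i]) : R[i] :=
  limn (series (fun n => \sum_(L : n.-tuple 'I_d) a L) : nat -> R[i]^o).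

Definition K (s t : R) : R[i] :=
  word_sum (fun L => 'i ^+ size L * (phi L)%:R * signature L s t).

Definition K_component (I : seq 'I_d) (s t : R) : R[i] :=
  word_sum (fun L =>
    'i ^+ (size L + size I) * (phi (L ++ rev I))%:R * signature L s t).

(* K(s, u_1) K(u_1, u_2) ... K(u_m, t) *)
Fixpoint K_chain (s t : R) (us : seq R) : R[i] :=
  if us is u :: us' then K s u * K_chain u t us' else K s t.

Definition K_int (J : seq 'I_d) (s t : R) : R[i] :=
  (- 1) ^+ size J * iter_int J (K_chain s t) s t.

Lemma K_int_nil s t : K_int [::] s t = K s t.
Proof. by rewrite /K_int /iter_int /= expr0 mul1r. Qed.

End Path.
End SchwingerDyson.

(* Letters are numbered from 1, to agree with the points of a matching. *)
Definition letter (d : nat) (I : seq 'I_d) (a : nat) : option 'I_d :=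
  onth I a.-1.

(* i_{U_1} ... i_{U_r} for U = U_1 ... U_r; no position in 1, ..., size I is
   dropped. *)
Definition subword (d : nat) (I : seq 'I_d) (U : seq nat) : seq 'I_d :=
  pmap (letter I) U.

(* Main.v *)
Require Import Defs.
From HB Require Import structures.
From mathcomp Require Import all_boot all_order all_algebra.
From mathcomp Require Import finmap.
From mathcomp Require Import all_classical all_reals all_analysis.
From mathcomp Require Import complex ring lra zify.
Import Order.TTheory GRing.Theory Num.Theory.
Import numFieldNormedType.Exports.
Set Implicit Arguments.
Unset Strict Implicit.
Unset Printing Implicit Defensive.
Local Open Scope classical_set_scope.
Local Open Scope ring_scope.

(** Both sides are linear combinations of the iterated integrals of the path, and the theorem says
    that the coefficients agree.

    Combinatorics. A non-crossing pairing is a run of a stack: reading a word backwards, each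
    letter is pushed, or pops an equal letter off the top, and the stack must be empty at the end.
    Let [stack_count w l J] count the runs that read [l], start from the stack [J] and end with the
    empty stack, each pop having weight [w]. A letter of the initial stack is popped by one
    letter of [l], which cuts [l] in two; this gives the product formula [stack_count_split].
    Applied to interval pairings it identifies [phi] with [stack_count 1] ([phi_stack_count]).
    As a pop removes two letters, the powers of [i] in the kernel turn the weight [1] into [-1]
    ([stack_count_scale]); in particular every coefficient is real. Finally, unrolling the first
    steps of the stack on the word [I] reproduces the recursion of [NC]: the next letter is pushed,
    and remains unmatched, or it pops the last unmatched letter, with weight [-1]
    ([NC_sum_stack_count]). So the coefficient of a word in the component of index [I] is the sum
    over [pi] in [NC] of the weight of [pi] times the count, with weight [-1], of the runs
    starting from the unmatched letters of [pi].

    Analysis. It remains to expand the iterated integral of the kernel along a word [U] as the sum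
    over words of [stack_count (-1)] started from [U], times the signature ([K_int_expansion]).
    Since the last variable is outermost, the integral along [U j] is the opposite of the integral
    against the [j]-th coordinate, at time [u], of the product of the one along [U], up to [u],
    with the kernel from [u] to [t]. For two signatures such an integral concatenates the words
    ([real_sig_concat], from the exchange of integrals [real_sig_fubini]), and
    [stack_count_split] says that the coefficients multiply in the same way. Both factors are
    uniform limits of their partial sums, the level of length [n] being of size [8 ^ - n], which
    allows to integrate term by term ([has_RS_int_limit]).

    All integrals are handled through one continuous increasing function [v], the sum of the total
    variations of the coordinates. The integrands are Lipschitz with respect to [v], so that the
    integral of [f] against [g] is the function whose increment over [[x, y]] is
    [f x * (g y - g x)] up to a multiple of the square of [v y - v x]. Such a function exists
    ([primitive_exists]) and is unique, because an error of second order over every interval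
    vanishes ([le_of_quadratic]). The bounds on integrals and the exchange of integrals follow from
    these two facts. *)

(** * Words, stacks and sums over words of a given length *)

Section Words.
Variables (A : comNzRingType) (L : eqType).
Implicit Types (l J : seq L) (h : seq L -> seq L -> A).

(** The word [l] is read from its head, and is thus the reversal of a word of the signature; the
    head of [J] is the top of the stack. *)
Fixpoint stack_count (w : A) l J : A :=
  if l is i :: l' then
    stack_count w l' (i :: J) +
    (if J is j :: J' then w * (i == j)%:R * stack_count w l' J' else 0)
  else (J == [::])%:R.

(** The sum of [h B C] over the factorizations [l = B ++ j :: C]. *)
Fixpoint split_sum (j : L) h l : A :=
  if l is i :: l' then
    (i == j)%:R * h [::] l' + split_sum j (fun B C => h (i :: B) C) l'
  else 0.

Lemma eq_split_sum j h1 h2 l :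
  (forall B C, h1 B C = h2 B C) -> split_sum j h1 l = split_sum j h2 l.
Proof.
by elim: l h1 h2 => //= i l IHl h1 h2 h12; rewrite h12; congr (_ + _); apply: IHl.
Qed.

Lemma split_sumD j h1 h2 l :
  split_sum j (fun B C => h1 B C + h2 B C) l = split_sum j h1 l + split_sum j h2 l.
Proof.
elim: l h1 h2 => [|i l IHl] h1 h2 /=; first by rewrite addr0.
by rewrite IHl mulrDr addrACA.
Qed.

Lemma split_sumZ j c h l :
  split_sum j (fun B C => c * h B C) l = c * split_sum j h l.
Proof.
elim: l h => [|i l IHl] h /=; first by rewrite mulr0.
by rewrite IHl mulrDr mulrCA.
Qed.

Lemma split_sum_mulr j h (f : seq L -> A) l :
  split_sum j h l * f l = split_sum j (fun B C => h B C * f (B ++ j :: C)) l.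
Proof.
elim: l h f => [|i l IHl] h f /=; first by rewrite mul0r.
rewrite mulrDl (IHl _ (fun l => f (i :: l))); congr (_ + _).
by case: eqP => [->|]; rewrite ?mul0r // !mul1r.
Qed.

(** The letter [j] is popped at one definite moment. The part of [l] read before has to clear
    the letters [J1] above it, and the part read after has to clear [J]. The letters [J1] are
    there for the induction: the case of interest is an empty [J1]. *)
Lemma stack_count_split w l J1 j J :
  stack_count w l (J1 ++ j :: J) =
  w * split_sum j (fun B C => stack_count w B J1 * stack_count w C J) l.
Proof.
elim: l J1 => [|i l IHl] J1 /=; first by case: J1; rewrite mulr0.
rewrite -cat_cons IHl mulrDr addrC -mulrDr.
case: J1 => [|k J1] /=.
  rewrite mul1r -mulrA -mulrDr; congr (_ * (_ + _)).
  by under [RHS]eq_split_sum do rewrite addr0.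
rewrite mul0r mulr0 add0r IHl -[in LHS](mulrA w) -mulrDr; congr (_ * _).
under [in RHS]eq_split_sum do rewrite mulrDl -[w * _ * _ * _]mulrA.
by rewrite split_sumD split_sumZ addrC mulrA [_ * w]mulrC.
Qed.

(** A run has as many pushes, counting the letters of the initial stack, as pops, so that each
    pop can absorb two factors [c]. With [c] the imaginary unit this turns the weight [1] into
    [-1]. *)
Lemma stack_count_scale (c w : A) l J :
  c ^+ (size l + size J) * stack_count w l J = stack_count (c ^+ 2 * w) l J.
Proof.
elim: l J => [|i l IHl] J /=.
  by case: J => [|j J]; rewrite ?mulr0 //= expr0 mul1r.
rewrite mulrDr -{1}(IHl (i :: J)) /= addSnnS; congr (_ + _).
case: J => [|j J]; first by rewrite mulr0.
by rewrite -IHl /= !addnS 2!exprS expr2; ring.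
Qed.

End Words.

Lemma rmorph_stack_count (A B : comNzRingType) (f : {rmorphism A -> B})
    (L : eqType) (w : A) (l J : seq L) :
  f (stack_count w l J) = stack_count (f w) l J.
Proof.
elim: l J => [|i l IHl] J /=; first by rewrite rmorph_nat.
rewrite rmorphD IHl; case: J => [|j J]; first by rewrite rmorph0.
by rewrite !rmorphM rmorph_nat IHl.
Qed.

(** Each letter read leaves at most two possibilities. *)
Lemma norm_stack_count (A : realDomainType) (L : eqType) (l J : seq L) :
  `|stack_count (- 1 : A) l J| <= 2 ^+ size l.
Proof.
elim: l J => [|i l IHl] J /=; first by rewrite expr0; case: eqP; rewrite ?normr1 ?normr0.
rewrite exprS mulr_natl mulr2n (le_trans (ler_normD _ _)) // lerD //.
case: J => [|j J]; first by rewrite normr0 exprn_ge0.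
rewrite !normrM normrN normr1 mul1r.
by case: eqP => _; rewrite ?normr0 ?mul0r ?exprn_ge0 // normr1 mul1r.
Qed.

Section LevelSum.
Variables (A : comNzRingType) (L : finType).
Implicit Types (x y : seq L -> A) (h : seq L -> seq L -> A).

(** The sum over the words of length [n], by recursion on the first letter as in [split_sum]
    rather than over tuples; see [level_sum_tuple]. *)
Fixpoint level_sum n x : A :=
  if n is n'.+1 then \sum_i level_sum n' (fun l => x (i :: l)) else x [::].

Lemma eq_level_sum n x y : (forall l, size l = n -> x l = y l) ->
  level_sum n x = level_sum n y.
Proof.
elim: n x y => [|n IHn] x y xy /=; first exact: xy.
by apply: eq_bigr => i _; apply: IHn => l ln; apply: xy; rewrite /= ln.
Qed.

Lemma level_sumD n x y :
  level_sum n (fun l => x l + y l) = level_sum n x + level_sum n y.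
Proof.
elim: n x y => [|n IHn] x y //=.
by rewrite -big_split; apply: eq_bigr => i _; apply: IHn.
Qed.

Lemma level_sumZ n c x : level_sum n (fun l => c * x l) = c * level_sum n x.
Proof.
elim: n x => [|n IHn] x //=.
by rewrite mulr_sumr; apply: eq_bigr => i _; apply: IHn.
Qed.

Lemma level_sum0 n : level_sum n (fun=> 0) = 0.
Proof. by elim: n => //= n IHn; apply: big1. Qed.

Lemma level_sum_linear n (I : Type) (r : seq I) (a : I -> A) (f : I -> seq L -> A) :
  level_sum n (fun l => \sum_(i <- r) a i * f i l) =
  \sum_(i <- r) a i * level_sum n (f i).
Proof.
elim: r => [|i r IHr].
  rewrite big_nil -[RHS](level_sum0 n); apply: eq_level_sum => l _.
  by rewrite big_nil.
rewrite big_cons -IHr -level_sumZ -level_sumD; apply: eq_level_sum => l _.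
by rewrite big_cons.
Qed.

Lemma level_sum_tuple n x : \sum_(t : n.-tuple L) x t = level_sum n x.
Proof.
elim: n x => [|n IHn] x /=.
  by rewrite (big_pred1 [tuple]) // => t; apply/esym/eqP; apply: tuple0.
under [RHS]eq_bigr => i _ do rewrite -IHn.
rewrite pair_big (reindex (fun p : L * n.-tuple L => [tuple of p.1 :: p.2])) //=.
exists (fun t : n.+1.-tuple L => (thead t, [tuple of behead t])).
  by move=> [i t] _; congr (_, _); apply: val_inj.
by move=> t _; rewrite [RHS]tuple_eta.
Qed.

Lemma level_sum_rev n x :
  \sum_(t : n.-tuple L) x (rev t) = level_sum n x.
Proof.
rewrite -level_sum_tuple [RHS](reindex (fun t : n.-tuple L => [tuple of rev t])) //=.
by exists (fun t : n.-tuple L => [tuple of rev t]) => t _;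
  apply: val_inj; rewrite /= revK.
Qed.

Lemma level_sumS n x : level_sum n.+1 x = \sum_i level_sum n (fun l => x (i :: l)).
Proof. by []. Qed.

(** Choosing a word of length [n + 1] together with an occurrence of [j] amounts to choosing the
    two factors around it, whose lengths add up to [n]. *)
Lemma level_sum_split j h n :
  level_sum n.+1 (split_sum j h) =
  \sum_(p < n.+1) level_sum p (fun B => level_sum (n - p) (fun C => h B C)).
Proof.
elim: n h => [|n IHn] h.
  rewrite big_ord1 /= (bigD1 j) //= eqxx mul1r addr0 big1 ?addr0 // => i /negbTE ->.
  by rewrite mul0r addr0.
rewrite level_sumS big_ord_recl; under eq_bigr => i _.
  rewrite (level_sumD n.+1 (fun l => (i == j)%:R * h [::] l)
    (split_sum j (fun B C => h (i :: B) C))) level_sumZ IHn; over.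
rewrite big_split /=; congr (_ + _).
  rewrite (bigD1 j) //= eqxx mul1r [X in _ + X]big1 ?addr0 // => i /negbTE ->.
  by rewrite mul0r.
by rewrite exchange_big; apply: eq_bigr => p _; rewrite subSS.
Qed.

End LevelSum.

Lemma norm_level_sum (A : realDomainType) (L : finType) n (x : seq L -> A) c :
  (forall l, size l = n -> `|x l| <= c) -> `|level_sum n x| <= #|L|%:R ^+ n * c.
Proof.
elim: n x => [|n IHn] x xc /=; first by rewrite expr0 mul1r xc.
apply: (le_trans (ler_norm_sum _ _ _)).
apply: (@le_trans _ _ (\sum_(i : L) (#|L|%:R ^+ n * c))).
  by apply: ler_sum => i _; apply: IHn => l ln; apply: xc; rewrite /= ln.
by rewrite sumr_const exprS -mulrA mulr_natl.
Qed.

(** * Non-crossing pairings and stacks *)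

Section Pairings.
Variables (d : nat) (W : seq 'I_d).
Local Notation N := (size W).
Local Notation w := (tnth (in_tuple W)).
Implicit Types (a b : nat) (i k x y z t : 'I_N) (P : {set {set 'I_N}}).

Definition points a b : {set 'I_N} := [set i : 'I_N | (a <= i < b)%N]%SET.

(** The conditions on a non-crossing pairing of the points of [[a, b)], with the blocks given by
    their ordered elements. *)
Definition pairings_of a b P : Prop :=
  [/\ forall B, B \in P -> exists x y, [/\ B = [set x; y]%SET, (x < y)%N,
        (a <= x)%N, (y < b)%N & w x = w y],
      forall x, (a <= x < b)%N -> exists2 B, B \in P & x \in B,
      forall B C x, B \in P -> C \in P -> x \in B -> x \in C -> B = C
    & forall x y z t, (x < y)%N -> (y < z)%N -> (z < t)%N ->
        [set x; z]%SET \in P -> [set y; t]%SET \in P -> False].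

(** Pairings of all the intervals live in the same type of subsets of positions of [W], so that
    cutting a pairing into two smaller ones requires no renumbering. *)
Definition interval_pairings a b : {set {set {set 'I_N}}} :=
  [set P : {set {set 'I_N}} |
     [&& finset.partition P (points a b),
         [forall B in P, #|B| == 2%N],
         [forall x : 'I_N, forall y : 'I_N, ([set x; y]%SET \in P) ==> (w x == w y)]
       & noncrossing P]]%SET.

Lemma interval_pairingsP a b P :
  reflect (pairings_of a b P) (P \in interval_pairings a b).
Proof.
rewrite inE; apply: (iffP and4P).
  move=> [/and3P[/eqP covP trivP _] /forall_inP cardP /forallP wP /forallP ncP].
  split.
  - move=> B BP; have /cards2P[x [y [xy BE]]] := cardP _ BP.
    have BD : B \subset points a b by rewrite -covP; apply: (finset.bigcup_max B).
    have xD : x \in points a b by apply: (fintype.subsetP BD); rewrite BE !inE eqxx.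
    have yD : y \in points a b by apply: (fintype.subsetP BD); rewrite BE !inE eqxx orbT.
    have /eqP wxy : w x == w y.
      by apply: (implyP (forallP (wP x) y)); rewrite -BE.
    move: xD yD; rewrite !inE => /andP[ax xb] /andP[ay yb].
    have : (x : nat) != y by [].
    rewrite neq_ltn => /orP[lt|lt].
      by exists x, y.
    by exists y, x; split=> //; rewrite finset.setUC.
  - move=> x xab; have : x \in finset.cover P by rewrite covP inE.
    by case/finset.bigcupP => B BP xB; exists B.
  - move=> B C x BP CP xB xC; apply/eqP; apply: contraT => BC.
    have /finset.trivIsetP/(_ _ _ BP CP BC) := trivP.
    by rewrite -finset.setI_eq0 => /eqP/finset.setP/(_ x); rewrite !inE xB xC.
  - move=> x y z t xy yz zt xzP.
    move: (ncP x) => /forallP/(_ y)/forallP/(_ z)/forallP/(_ t).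
    by rewrite xy yz zt xzP /= => /negP.
move=> [blk cov dis nc]; split.
- apply/and3P; split.
  + apply/eqP/finset.setP => x; rewrite inE; apply/bigcupP/idP => [[B BP]|/cov[B BP xB]].
      have [y [z [-> yz ay zb _]]] := blk _ BP.
      by rewrite !inE => /orP[]/eqP->; lia.
    by exists B.
  + apply/finset.trivIsetP => B C BP CP; apply: contraR => /pred0Pn[x /andP[xB xC]].
    by apply/eqP; apply: (dis _ _ x).
  + apply/negP => /blk [x [y [/finset.setP/(_ x)]]].
    by rewrite !inE eqxx.
- apply/forall_inP => B /blk[x [y [-> xy _ _ _]]].
  by rewrite cards2 -val_eqE /= neq_ltn xy.
- apply/forallP => x; apply/forallP => y; apply/implyP => /blk[z [t [E _ _ _ wzt]]].
  have : x \in [set z; t]%SET by rewrite -E !inE eqxx.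
  have : y \in [set z; t]%SET by rewrite -E !inE eqxx orbT.
  by rewrite !inE => /orP[]/eqP-> /orP[]/eqP->; rewrite ?wzt.
- apply/forallP => x; apply/forallP => y; apply/forallP => z; apply/forallP => t.
  apply/implyP => /and4P[xy yz zt xzP]; apply/negP => ytP.
  exact: nc xy yz zt xzP ytP.
Qed.

Lemma nc_pairingsE : nc_pairings W = interval_pairings 0 N.
Proof.
rewrite /nc_pairings /interval_pairings (_ : points 0 N = [set: 'I_N]%SET) //.
by apply/finset.setP => x; rewrite !inE ltn_ord.
Qed.

Lemma set2_ltn_inj (x y z t : 'I_N) : (x < y)%N -> (z < t)%N ->
  [set x; y]%SET = [set z; t]%SET -> x = z /\ y = t.
Proof.
move=> xy zt E.
have : x \in [set z; t]%SET by rewrite -E !inE eqxx.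
have : y \in [set z; t]%SET by rewrite -E !inE eqxx orbT.
rewrite !inE => /orP[]/eqP yE /orP[]/eqP xE //; subst.
- by rewrite ltnn in xy.
- by move: (ltn_trans xy zt); rewrite ltnn.
- by rewrite ltnn in xy.
Qed.

Section LastBlock.
Variables (a b : nat) (k beta : 'I_N).
Hypotheses (ak : (a <= k)%N) (kb : (k < b)%N) (betaE : beta = b :> nat)
  (wk : w k = w beta).

(** If the last point [beta] is paired with [k], the remaining blocks lie on one side of [k], and
    the pairing is recovered from its parts on [[a, k)] and on [(k, b)]. *)
Definition glue (Q : {set {set 'I_N}} * {set {set 'I_N}}) : {set {set 'I_N}} :=
  ([set k; beta] |: (Q.1 :|: Q.2))%SET.

Lemma glueP Q : Q \in finset.setX (interval_pairings a k) (interval_pairings k.+1 b) ->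
  glue Q \in interval_pairings a b.+1.
Proof.
case: Q => P1 P2; rewrite finset.in_setX /= => /andP[/interval_pairingsP[b1 c1 d1 n1]
  /interval_pairingsP[b2 c2 d2 n2]].
have inG B : B \in glue (P1, P2) -> [\/ B = [set k; beta]%SET, B \in P1 | B \in P2].
  by rewrite !inE /= => /orP[/eqP->|/orP[]]; [constructor 1|constructor 2|constructor 3].
have r1 B x : B \in P1 -> x \in B -> (x < k)%N.
  by move=> /b1[y [z [-> yz _ zk _]]]; rewrite !inE => /orP[]/eqP->; lia.
have r2 B x : B \in P2 -> x \in B -> (k < x < b)%N.
  by move=> /b2[y [z [-> yz ky zk _]]]; rewrite !inE => /orP[]/eqP->; lia.
have r0 x : x \in [set k; beta]%SET -> x = k :> nat \/ x = b :> nat.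
  by rewrite !inE => /orP[]/eqP->; [left|right].
apply/interval_pairingsP; split.
- move=> B /inG[->|/b1[x [y [-> xy ax yk wxy]]]|/b2[x [y [-> xy ax yk wxy]]]].
  + by exists k, beta; split=> //; lia.
  + by exists x, y; split=> //; lia.
  + by exists x, y; split=> //; lia.
- move=> x /andP[ax xb].
  have [xk|kx|xk] := ltngtP x k.
  + have [|B BP xB] := c1 x; first by rewrite ax.
    by exists B => //; rewrite !inE BP orbT.
  + move: xb; rewrite ltnS leq_eqVlt => /orP[/eqP xb|xb].
      have -> : x = beta by apply: val_inj; rewrite /= betaE.
      by exists [set k; beta]%SET; rewrite !inE eqxx ?orbT.
    have [|B BP xB] := c2 x; first by rewrite kx.
    by exists B => //; rewrite !inE BP !orbT.
  + have -> : x = k by apply: val_inj.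
    by exists [set k; beta]%SET; rewrite !inE eqxx.
- move=> B C x /inG[->|BP|BP] /inG[->|CP|CP] // xB xC.
  + by move: (r0 _ xB) (r1 _ _ CP xC); lia.
  + by move: (r0 _ xB) (r2 _ _ CP xC); lia.
  + by move: (r0 _ xC) (r1 _ _ BP xB); lia.
  + exact: d1 xB xC.
  + by move: (r1 _ _ BP xB) (r2 _ _ CP xC); lia.
  + by move: (r0 _ xC) (r2 _ _ BP xB); lia.
  + by move: (r2 _ _ BP xB) (r1 _ _ CP xC); lia.
  + exact: d2 xB xC.
- move=> x y z t xy yz zt xzP ytP.
  have xin : x \in [set x; z]%SET by rewrite !inE eqxx.
  have zin : z \in [set x; z]%SET by rewrite !inE eqxx orbT.
  have yin : y \in [set y; t]%SET by rewrite !inE eqxx.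
  have tin : t \in [set y; t]%SET by rewrite !inE eqxx orbT.
  case/inG: xzP => [E|P1xz|P2xz]; case/inG: ytP => [E'|P1yt|P2yt].
  + by rewrite E in xin zin; rewrite E' in yin tin;
      move: (r0 _ xin) (r0 _ zin) (r0 _ yin) (r0 _ tin); lia.
  + rewrite E in xin zin;
      move: (r0 _ xin) (r0 _ zin) (r1 _ _ P1yt yin) (r1 _ _ P1yt tin); lia.
  + rewrite E in xin zin;
      move: (r0 _ xin) (r0 _ zin) (r2 _ _ P2yt yin) (r2 _ _ P2yt tin); lia.
  + rewrite E' in yin tin;
      move: (r0 _ yin) (r0 _ tin) (r1 _ _ P1xz xin) (r1 _ _ P1xz zin); lia.
  + exact: n1 xy yz zt P1xz P1yt.
  + by move: (r1 _ _ P1xz zin) (r2 _ _ P2yt yin); lia.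
  + rewrite E' in yin tin;
      move: (r0 _ yin) (r0 _ tin) (r2 _ _ P2xz xin) (r2 _ _ P2xz zin); lia.
  + by move: (r2 _ _ P2xz xin) (r1 _ _ P1yt yin); lia.
  + exact: n2 xy yz zt P2xz P2yt.
Qed.

(** The two parts are told apart by the position of their blocks, which are not empty. *)
Lemma glue_inj :
  {in finset.setX (interval_pairings a k) (interval_pairings k.+1 b) &, injective glue}.
Proof.
have key a' b' B P (x y : 'I_N) : P \in interval_pairings a' b' -> B \in P ->
    exists2 x, x \in B & (a' <= x < b')%N.
  move=> /interval_pairingsP[blk _ _ _] /blk[z [t [-> zt az tb _]]].
  by exists z; rewrite ?inE ?eqxx //; lia.
have sub P1 P2 B : P1 \in interval_pairings a k -> P2 \in interval_pairings k.+1 b ->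
    ((B \in P1) = (B \in glue (P1, P2)) && (B \subset points a k)) *
    ((B \in P2) = (B \in glue (P1, P2)) && (B \subset points k.+1 b)).
  move=> P1in P2in; rewrite !inE /=.
  have /interval_pairingsP[b1 _ _ _] := P1in.
  have /interval_pairingsP[b2 _ _ _] := P2in.
  have s1 : B \in P1 -> B \subset points a k.
    move=> /b1[x [y [-> xy ax yk _]]]; apply/fintype.subsetP => z.
    by rewrite !inE => /orP[]/eqP->; lia.
  have s2 : B \in P2 -> B \subset points k.+1 b.
    move=> /b2[x [y [-> xy ax yk _]]]; apply/fintype.subsetP => z.
    by rewrite !inE => /orP[]/eqP->; lia.
  split; apply/idP/andP.
  - by move=> BP; rewrite s1 // BP orbT.
  - case=> /orP[/eqP->|/orP[//|BP]] /fintype.subsetP BD.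
      by have := BD k; rewrite !inE eqxx ltnn andbF => /(_ isT).
    have [x xB] := key _ _ _ _ k k P2in BP.
    by have := BD _ xB; rewrite inE; lia.
  - by move=> BP; rewrite s2 // BP !orbT.
  - case=> /orP[/eqP->|/orP[BP|//]] /fintype.subsetP BD.
      by have := BD k; rewrite !inE eqxx ltnn => /(_ isT).
    have [x xB] := key _ _ _ _ k k P1in BP.
    by have := BD _ xB; rewrite inE; lia.
move=> [P1 P2] [Q1 Q2]; rewrite !finset.in_setX /= => /andP[P1in P2in] /andP[Q1in Q2in] E.
congr (_, _); apply/finset.setP => B.
  by rewrite !(sub _ _ _ P1in P2in) !(sub _ _ _ Q1in Q2in) E.
by rewrite !(sub _ _ _ P1in P2in) !(sub _ _ _ Q1in Q2in) E.
Qed.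

(** A block with one point on each side of [k] would cross the block of [k] and [beta]. *)
Lemma glue_onto P : P \in interval_pairings a b.+1 -> [set k; beta]%SET \in P ->
  P \in [set glue Q | Q in finset.setX (interval_pairings a k) (interval_pairings k.+1 b)]%SET.
Proof.
move=> /interval_pairingsP[blk cov dis nc] kP.
pose P1 := [set B in P | B \subset points a k]%SET.
pose P2 := [set B in P | B \subset points k.+1 b]%SET.
have tri B : B \in P -> [\/ B = [set k; beta]%SET, B \in P1 | B \in P2].
  move=> BP; have [E|/eqP BN] := eqVneq B [set k; beta]%SET; first by constructor 1.
  have [x [y [BE xy ax yb _]]] := blk _ BP.
  have xB : x \in B by rewrite BE !inE eqxx.
  have yB : y \in B by rewrite BE !inE eqxx orbT.
  have ne z : z \in B -> z <> k :> nat /\ z <> b :> nat.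
    move=> zB; split=> zE; apply: BN; apply: (dis _ _ z) => //; rewrite !inE -!val_eqE /=.
      by rewrite zE eqxx.
    by rewrite zE betaE eqxx orbT.
  have [xk xb] := ne _ xB; have [yk yb'] := ne _ yB.
  case: (ltnP k x) => kx.
    constructor 3; rewrite inE BP BE; apply/fintype.subsetP => z.
    by rewrite !inE => /orP[]/eqP->; lia.
  constructor 2; rewrite inE BP BE; apply/fintype.subsetP => z.
  suff yk' : (y < k)%N by rewrite !inE => /orP[]/eqP->; lia.
  rewrite ltnNge; apply/negP => ky.
  apply: (nc x k y beta) => //; rewrite -?BE //; lia.
have in1 B x : B \in P1 -> x \in B -> (a <= x < k)%N.
  by rewrite inE => /andP[_ /fintype.subsetP BD] /BD; rewrite inE.
have in2 B x : B \in P2 -> x \in B -> (k < x < b)%N.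
  by rewrite inE => /andP[_ /fintype.subsetP BD] /BD; rewrite inE.
have PE : P = glue (P1, P2).
  apply/finset.setP => B; rewrite !inE /=; apply/idP/idP => [/tri[->|BP|BP]|].
  - by rewrite eqxx.
  - by move: BP; rewrite inE => ->; rewrite orbT.
  - by move: BP; rewrite inE => ->; rewrite !orbT.
  - by move=> /orP[/eqP->//|/orP[]/andP[]].
apply/imsetP; exists (P1, P2) => //; rewrite finset.in_setX /=; apply/andP.
split; apply/interval_pairingsP; split.
- move=> B BP; move: (BP); rewrite inE => /andP[/blk[x [y [E xy ax yb wxy]]] _].
  exists x, y; split=> //.
  by have /andP[] : (a <= y < k)%N by apply: (in1 _ _ BP); rewrite E !inE eqxx orbT.
- move=> x /andP[ax xk]; have [|B BP xB] := cov x; first lia.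
  exists B => //; case/tri: BP => [E|//|BP].
    by move: xB; rewrite E !inE -!val_eqE /= => /orP[]/eqP; lia.
  by have := in2 _ _ BP xB; lia.
- by move=> B C x; rewrite !inE => /andP[BP _] /andP[CP _]; apply: dis.
- move=> x y z t xy yz zt; rewrite !inE => /andP[? _] /andP[? _].
  exact: nc xy yz zt _ _.
- move=> B BP; move: (BP); rewrite inE => /andP[/blk[x [y [E xy ax yb wxy]]] _].
  exists x, y; split=> //.
    by have /andP[] : (k < x < b)%N by apply: (in2 _ _ BP); rewrite E !inE eqxx.
  by have /andP[] : (k < y < b)%N by apply: (in2 _ _ BP); rewrite E !inE eqxx orbT.
- move=> x /andP[kx xb]; have [|B BP xB] := cov x; first lia.
  exists B => //; case/tri: BP => [E|BP|//].
    by move: xB; rewrite E !inE -!val_eqE /= => /orP[]/eqP; lia.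
  by have := in1 _ _ BP xB; lia.
- by move=> B C x; rewrite !inE => /andP[BP _] /andP[CP _]; apply: dis.
- move=> x y z t xy yz zt; rewrite !inE => /andP[? _] /andP[? _].
  exact: nc xy yz zt _ _.
Qed.

Lemma card_last_block :
  #|[set P in interval_pairings a b.+1 | [set k; beta]%SET \in P]%SET| =
  (#|interval_pairings a k| * #|interval_pairings k.+1 b|)%N.
Proof.
rewrite -finset.cardsX -(card_in_imset glue_inj); apply: eq_card => P; rewrite inE.
apply/andP/idP => [[]|]; first exact: glue_onto.
by case/imsetP => Q /glueP gQ ->; rewrite gQ !inE eqxx.
Qed.

End LastBlock.

(** The decomposition according to the partner [k] of the last point. *)
Lemma card_interval_pairings_rec a b (beta : 'I_N) : beta = b :> nat -> (a <= b)%N ->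
  #|interval_pairings a b.+1| =
  (\sum_(k : 'I_N | a <= k < b)
    (w k == w beta) * (#|interval_pairings a k| * #|interval_pairings k.+1 b|))%N.
Proof.
move=> betaE ab.
have -> : #|interval_pairings a b.+1| =
    (\sum_(P in interval_pairings a b.+1)
       \sum_(k : 'I_N | a <= k < b) ([set k; beta]%SET \in P))%N.
  rewrite -sum1_card; apply: eq_bigr => P /interval_pairingsP[blk cov dis _].
  have [|B BP bB] := cov beta; first by lia.
  have [x [y [BE xy ax yb _]]] := blk _ BP.
  have yE : y = beta.
    move: bB; rewrite BE !inE => /orP[]/eqP // bx; subst x.
    by move: xy yb; rewrite betaE; lia.
  subst y; rewrite (bigD1 x) /=; last by lia.
  rewrite -BE BP big1 // => k /andP[kab kx].
  apply/eqP; rewrite eqb0; apply/negP => kP.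
  have : [set k; beta]%SET = B.
    by apply: (dis _ _ beta) => //; rewrite !inE eqxx orbT.
  rewrite BE => /finset.setP/(_ k); rewrite !inE eqxx (negbTE kx) /= => /esym/eqP kb.
  by move: kab; rewrite kb betaE; lia.
rewrite exchange_big; apply: eq_bigr => k /andP[ak kb] /=.
have -> : (\sum_(P in interval_pairings a b.+1) ([set k; beta]%SET \in P) =
    #|[set P in interval_pairings a b.+1 | [set k; beta]%SET \in P]%SET|)%N.
  by rewrite -big_mkcondr -sum1_card; apply: eq_bigl => P; rewrite !inE.
have [wk|wk] := eqVneq (w k) (w beta); first by rewrite mul1n; apply: card_last_block.
rewrite mul0n; apply: eq_card0 => P; rewrite inE; apply/negP.
move=> /andP[/interval_pairingsP[blk _ _ _]] /blk[x [y [E xy _ _ wxy]]].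
have [] := set2_ltn_inj _ xy E; first by lia.
by move=> kx bx; move: wk; rewrite kx bx wxy eqxx.
Qed.

Lemma card_interval_pairings0 a b : (b <= a)%N -> #|interval_pairings a b| = 1%N.
Proof.
move=> ba; rewrite -(cards1 (@finset.set0 {set 'I_N})); apply: eq_card => P.
rewrite finset.in_set1; apply/interval_pairingsP/eqP => [[blk _ _ _]|->].
  apply/finset.setP => B; rewrite inE; apply/negP => /blk[x [y [_ xy ax yb _]]]; lia.
split; [by move=> B; rewrite inE|by move=> x; lia|by move=> B C x; rewrite inE|].
by move=> x y z t _ _ _; rewrite inE.
Qed.

(** The letters at the positions in [[a, b)], in the order in which a stack reads them. *)
Definition rev_factor a b := rev (drop a (take b W)).

Lemma rev_factor0 a b : (b <= a)%N -> rev_factor a b = [::].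
Proof.
by move=> ba; rewrite /rev_factor drop_oversize // size_take; case: ifP => //; lia.
Qed.

Lemma rev_factorS a b (beta : 'I_N) : beta = b :> nat -> (a <= b)%N ->
  rev_factor a b.+1 = w beta :: rev_factor a b.
Proof.
move=> betaE ab; have bN : (b < N)%N by rewrite -betaE.
rewrite /rev_factor (take_nth (w beta)) // drop_rcons; last by rewrite size_takel // ltnW.
rewrite rev_rcons; congr (_ :: _).
by rewrite [RHS](tnth_nth (w beta)) /= betaE.
Qed.

Lemma split_sum_rev_factor (A : comNzRingType) j (h : seq 'I_d -> seq 'I_d -> A) a b :
  (b <= N)%N -> split_sum j h (rev_factor a b) =
  \sum_(k : 'I_N | (a <= k < b)%N) (w k == j)%:R * h (rev_factor k.+1 b) (rev_factor a k).
Proof.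
elim: b h => [|b IHb] h bN.
  by rewrite rev_factor0 //= big1 // => k; rewrite ltn0 andbF.
case: (leqP a b) => [ab|ba]; last first.
  by rewrite rev_factor0 //= big_pred0 // => k; lia.
pose beta := Ordinal bN.
rewrite (rev_factorS (beta := beta)) //= IHb; last exact: ltnW.
rewrite [RHS](bigD1 beta) /=; last by lia.
rewrite (@rev_factor0 b.+1) //; congr (_ + _); apply: eq_big => k.
  by rewrite -val_eqE /=; lia.
by move=> /andP[_ kb]; rewrite (rev_factorS (beta := beta)).
Qed.

(** Both sides satisfy the recursion of [card_interval_pairings_rec]: on the right it is
    [stack_count_split], the last letter being the first one pushed. *)
Lemma card_interval_pairings (A : comNzRingType) a b : (b <= N)%N ->
  #|interval_pairings a b|%:R = stack_count (1 : A) (rev_factor a b) [::].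
Proof.
have [n] := ubnP (b - a); elim: n a b => // n IHn a [|b] ban bN.
  by rewrite rev_factor0 // card_interval_pairings0.
case: (leqP a b) => [ab|ba]; last by rewrite rev_factor0 // card_interval_pairings0.
pose beta := Ordinal bN.
rewrite (rev_factorS (beta := beta)) //= addr0 (stack_count_split _ _ [::]) mul1r.
rewrite split_sum_rev_factor; last exact: ltnW.
rewrite (card_interval_pairings_rec (beta := beta)) // natr_sum.
apply: eq_bigr => k /andP[ak kb]; rewrite !natrM !IHn; try by lia.
by rewrite [X in _ * X]mulrC.
Qed.

Lemma phi_stack_count (A : comNzRingType) :
  (phi W)%:R = stack_count (1 : A) (rev W) [::].
Proof.
by rewrite /phi nc_pairingsE card_interval_pairings // /rev_factor take_size drop0.
Qed.

End Pairings.

(** * The recursion defining NC *)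

Section Matchings.
Local Open Scope fset_scope.
Implicit Types (pi : matching) (B : {fset nat}) (n m a b x : nat).

(** The default value [0] of [last] is used only if every point is matched. *)
Definition top n pi : nat := last 0%N (unmatched n pi).
Definition add_point n pi : matching := pi `|` [fset [fset n.+1]].
Definition add_pair n pi : matching :=
  (pi `\ [fset top n pi]) `|` [fset [fset top n pi; n.+1]].

Lemma mem_unmatched n pi x :
  (x \in unmatched n pi) = (1 <= x <= n)%N && ([fset x] \in pi).
Proof. by rewrite mem_filter mem_iota add1n ltnS andbC. Qed.

Lemma mem_matched_pairs n pi a b :
  ((a, b) \in matched_pairs n pi) =
  [&& (1 <= a)%N, (a < b)%N, (b <= n)%N & [fset a; b] \in pi].
Proof.
rewrite mem_filter /=; apply/andP/and4P => [[/andP[ab abP] /allpairsP[[x y] [/=]]]|].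
  rewrite !mem_iota => xn yn [aE bE]; subst x y; split=> //; lia.
move=> [a1 ab bn abP]; rewrite ab abP; split=> //.
by apply/allpairsP; exists (a, b); rewrite !mem_iota; split=> //=; lia.
Qed.

Lemma uniq_matched_pairs n pi : uniq (matched_pairs n pi).
Proof. by apply/filter_uniq/allpairs_uniq; rewrite ?iota_uniq // => -[? ?] [? ?]. Qed.

Lemma uniq_unmatched n pi : uniq (unmatched n pi).
Proof. by rewrite filter_uniq ?iota_uniq. Qed.

Lemma top_unmatched n pi : unmatched n pi != [::] -> top n pi \in unmatched n pi.
Proof. by rewrite /top; case: unmatched => // x s _; apply: mem_last. Qed.

(** This makes [n.+1] a fresh point of every matching in [NC n], whence the injectivity and the
    disjointness in [NC_perm]. *)
Lemma NC_range n pi B x : pi \in NC n -> B \in pi -> x \in B -> (1 <= x <= n)%N.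
Proof.
elim: n pi B x => [|n IHn] pi B x; first by rewrite inE => /eqP->; rewrite inE.
have W C y rho : rho \in NC n -> C \in rho -> y \in C -> (1 <= y <= n.+1)%N.
  by move=> rhoN Cr yC; have := IHn _ _ _ rhoN Cr yC; lia.
rewrite /= inE => /orP[|] /imfsetP[/= rho].
  by move=> rhoN ->; rewrite !inE => /orP[/W|/eqP->]; [apply|rewrite inE => /eqP->; lia].
rewrite inE => /andP[rhoN ne] ->; rewrite !inE => /orP[/andP[_ /W]|/eqP->]; first exact.
rewrite !inE => /orP[]/eqP->; last lia.
by have := top_unmatched ne; rewrite mem_unmatched /top; lia.
Qed.

Lemma NC_fset1 n pi : pi \in NC n -> [fset n.+1] \in pi = false.
Proof.
by move=> piN; apply/negP => /(NC_range piN)/(_ (fset11 _)); rewrite ltnn andbF.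
Qed.

Lemma NC_fset2 n pi a : pi \in NC n -> [fset a; n.+1] \in pi = false.
Proof.
by move=> piN; apply/negP => /(NC_range piN)/(_ (fset22 _ _)); rewrite ltnn andbF.
Qed.

Lemma fset2_eq1 a b x : (a < b)%N -> ([fset a; b] == [fset x]) = false.
Proof.
move=> ab; apply/negP => /eqP/fsetP E.
by move: (E a) (E b); rewrite !inE !eqxx orbT; lia.
Qed.

Lemma fset2_inj a b x y : (a < b)%N -> (x < y)%N ->
  ([fset a; b] == [fset x; y]) = ((a, b) == (x, y)).
Proof.
move=> ab xy; apply/eqP/eqP => [/fsetP E|[-> ->]//].
suff [-> ->] : a = x /\ b = y by [].
by move: (E a) (E b) (E x) (E y); rewrite !inE !eqxx /=; lia.
Qed.

(** The two constructions of the recursion are injective and have disjoint images, so that a sum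
    over [NC n.+1] splits into two sums over [NC n]. *)
Lemma NC_perm n :
  perm_eq (NC n.+1) ([seq add_point n pi | pi <- NC n] ++
                     [seq add_pair n pi | pi <- NC n & unmatched n pi != [::]]).
Proof.
have add_pointI : {in NC n &, injective (add_point n)}.
  move=> pi rho piN rhoN /fsetP E; apply/fsetP => B; have := E B; rewrite !inE.
  by have [->|_] := eqVneq B [fset n.+1]; rewrite ?orbF // !NC_fset1.
have add_pairI : {in [pred pi in NC n | unmatched n pi != [::]] &, injective (add_pair n)}.
  move=> pi rho; rewrite !inE => /andP[piN pine] /andP[rhoN rhone] /fsetP E.
  have tp := top_unmatched pine; have tr := top_unmatched rhone.
  have topE : top n pi = top n rho.
    have := E [fset top n pi; n.+1]; rewrite !inE eqxx orbT !NC_fset2 // andbF /=.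
    move: tp tr; rewrite !mem_unmatched => /andP[tpn _] /andP[trn _].
    by rewrite fset2_inj; [move=> /esym/eqP[]|lia|lia].
  apply/fsetP => B; have := E B; rewrite !inE topE.
  have [->|_] /= := eqVneq B [fset top n rho].
    by move: tp tr; rewrite topE !mem_unmatched => /andP[_ ->] /andP[_ ->].
  by have [->|_] := eqVneq B [fset top n rho; n.+1]; rewrite ?orbF // !NC_fset2.
apply: uniq_perm => [||pi].
- exact: fset_uniq.
- rewrite cat_uniq !map_inj_in_uniq ?filter_uniq ?fset_uniq //=; last first.
    by move=> pi rho; rewrite !mem_filter => /andP[? ?] /andP[? ?]; apply: add_pairI;
      rewrite inE; apply/andP.
  rewrite andbT; apply/hasPn => _ /mapP[pi + ->]; rewrite mem_filter => /andP[ne piN].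
  apply/mapP => -[rho rhoN /fsetP/(_ [fset n.+1])].
  rewrite !inE eqxx orbT NC_fset1 // andbF /= eq_sym fset2_eq1 //.
  by have := top_unmatched ne; rewrite mem_unmatched; lia.
- rewrite mem_cat /= inE; congr (_ || _); apply/imfsetP/mapP => /= -[rho rhoN ->].
  + by exists rho.
  + by exists rho.
  + by exists rho; rewrite // mem_filter andbC.
  + by exists rho; rewrite // inE; move: rhoN; rewrite mem_filter andbC.
Qed.

Lemma iota1S n : iota 1 n.+1 = rcons (iota 1 n) n.+1.
Proof. by rewrite -[n.+1 in LHS]addn1 iotaD add1n cats1. Qed.

Lemma unmatched_add_point n pi : pi \in NC n ->
  unmatched n.+1 (add_point n pi) = rcons (unmatched n pi) n.+1.
Proof.
move=> piN; rewrite /unmatched iota1S filter_rcons !inE eqxx orbT.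
congr rcons; apply: eq_in_filter => x; rewrite mem_iota !inE => xn.
by rewrite (inj_eq (@fset1_inj _)) orbC; case: eqP => // xE; lia.
Qed.

(** Stated in this direction since it is used to expose the last unmatched point of [pi]. *)
Lemma unmatched_add_pair n pi : pi \in NC n -> unmatched n pi != [::] ->
  unmatched n pi = rcons (unmatched n.+1 (add_pair n pi)) (top n pi).
Proof.
move=> piN ne; have := top_unmatched ne; rewrite mem_unmatched => /andP[tn _].
have -> : unmatched n.+1 (add_pair n pi) = [seq x <- unmatched n pi | x != top n pi].
  rewrite /unmatched iota1S filter_rcons !inE NC_fset1 //.
  rewrite andbF /= eq_sym fset2_eq1 /=; last lia.
  rewrite -filter_predI; apply: eq_in_filter => x; rewrite mem_iota => xn /=.
  rewrite !inE (inj_eq (@fset1_inj _)) [_ == [fset _; _]]eq_sym fset2_eq1 ?orbF //; lia.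
have := uniq_unmatched n pi; rewrite /top.
case/lastP: (unmatched n pi) ne => // s x _; rewrite last_rcons rcons_uniq => /andP[xs _].
rewrite filter_rcons eqxx /=; congr rcons; apply/esym/all_filterP/allP => y ys.
by apply: contraNneq xs => <-.
Qed.

Lemma matched_pairs_add_point n pi : pi \in NC n ->
  perm_eq (matched_pairs n.+1 (add_point n pi)) (matched_pairs n pi).
Proof.
move=> piN; apply: uniq_perm; rewrite ?uniq_matched_pairs // => -[a b].
rewrite !mem_matched_pairs !inE; apply/and4P/and4P => -[a1 ab bn].
  rewrite fset2_eq1 // orbF => abP; split=> //.
  by have := NC_range piN abP (fset22 _ _); lia.
by move=> abP; split; rewrite ?abP //; lia.
Qed.

Lemma matched_pairs_add_pair n pi : pi \in NC n -> unmatched n pi != [::] ->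
  perm_eq (matched_pairs n.+1 (add_pair n pi)) ((top n pi, n.+1) :: matched_pairs n pi).
Proof.
move=> piN ne; have := top_unmatched ne; rewrite mem_unmatched => /andP[tn _].
apply: uniq_perm; rewrite /= ?uniq_matched_pairs ?andbT //.
  by rewrite mem_matched_pairs ltnn !andbF.
move=> [a b]; rewrite inE !mem_matched_pairs !inE.
have [ab|ab] := boolP (a < b)%N; last first.
  by rewrite /= !andbF orbF; apply/esym/eqP => -[aE bE]; lia.
rewrite fset2_eq1 // fset2_inj //=; last lia.
have [[-> ->]|] := (a, b) =P (top n pi, n.+1); first by rewrite orbT; lia.
rewrite orbF /= => _; apply/and3P/and3P => -[a1 bn abP]; split=> //; last lia.
by have := NC_range piN abP (fset22 _ _); lia.
Qed.

End Matchings.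

Section MatchingSums.
Variables (A : comNzRingType) (d : nat).
Implicit Types (I : seq 'I_d) (j : 'I_d).

Definition matching_weight I (pi : matching) : A :=
  \prod_(ab <- matched_pairs (size I) pi)
     ((- 1) * (letter I ab.1 == letter I ab.2)%:R).

Definition unmatched_word I (pi : matching) : seq 'I_d :=
  subword I (unmatched (size I) pi).

Lemma letter_rcons I j a : (1 <= a <= size I)%N -> letter (rcons I j) a = letter I a.
Proof.
by case: a => // a /= aI; rewrite /letter /= -cats1 onth_cat aI.
Qed.

Lemma letter_last I j : letter (rcons I j) (size I).+1 = Some j.
Proof. by rewrite /letter -cats1 onth_cat ltnn subnn. Qed.

Lemma letter_some I a : (1 <= a <= size I)%N -> exists i, letter I a = Some i.
Proof.
case: a => // a /= aI; rewrite /letter /=.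
by move: (onthTE I a); rewrite aI; case: (onth I a) => // i _; exists i.
Qed.

Lemma subword_rcons I j U :
  (forall x, x \in U -> (1 <= x <= size I)%N) ->
  subword (rcons I j) U = subword I U.
Proof.
move=> UI; rewrite /subword; elim: U UI => //= x U IHU UI.
rewrite letter_rcons; last by apply: UI; rewrite inE eqxx.
by rewrite IHU // => y yU; apply: UI; rewrite inE yU orbT.
Qed.

(** The two terms correspond to the two constructions: the new letter [j] stays unmatched, or it
    is matched with the last unmatched letter [k], which contributes a factor [-1] if they are
    equal and [0] otherwise. *)
Lemma NC_sum_rcons (f : seq 'I_d -> A) I j :
  \sum_(pi <- NC (size (rcons I j)))
     matching_weight (rcons I j) pi * f (unmatched_word (rcons I j) pi) =
  \sum_(pi <- NC (size I)) matching_weight I pi *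
     (f (rcons (unmatched_word I pi) j) +
      (if rev (unmatched_word I pi) is k :: U then - (j == k)%:R * f (rev U) else 0)).
Proof.
set n := size I.
have weight_eq pi rho : perm_eq (matched_pairs n.+1 rho) (matched_pairs n pi) ->
    matching_weight (rcons I j) rho = matching_weight I pi.
  rewrite /matching_weight size_rcons -/n => /(perm_big _) ->.
  rewrite big_seq [RHS]big_seq; apply: eq_bigr => -[a b].
  by rewrite mem_matched_pairs => /and4P[? ? ? _]; rewrite !letter_rcons //= -/n; lia.
rewrite size_rcons (perm_big _ (NC_perm _)) big_cat !big_map big_filter /= -/n.
under [in RHS]eq_bigr => pi _ do rewrite mulrDr.
rewrite big_split /= [in X in _ + X = _]big_mkcond /=; congr (_ + _).
  rewrite big_seq [RHS]big_seq; apply: eq_bigr => pi piN.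
  rewrite (weight_eq pi); last exact: matched_pairs_add_point.
  congr (_ * f _); rewrite /unmatched_word size_rcons -/n unmatched_add_point //.
  rewrite /subword -[rcons (unmatched n pi) _]cats1 pmap_cat /= letter_last /= cats1; congr rcons.
  by apply: subword_rcons => x; rewrite mem_unmatched => /andP[].
rewrite big_seq [RHS]big_seq; apply: eq_bigr => pi piN.
have [E|ne] /= := eqVneq (unmatched n pi) [::].
  by rewrite /unmatched_word -/n E /= mulr0.
have := top_unmatched ne; rewrite mem_unmatched => /andP[tn _].
have [k kE] := letter_some tn.
rewrite {2}/unmatched_word (unmatched_add_pair piN ne) /subword.
rewrite -[rcons _ (top n pi)]cats1 pmap_cat /= kE /=.
rewrite cats1 rev_rcons revK mulrA; congr (_ * f _); last first.
  rewrite /unmatched_word size_rcons; apply: subword_rcons => x xU.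
  have : x \in unmatched n pi by rewrite (unmatched_add_pair piN ne) mem_rcons inE xU orbT.
  by rewrite mem_unmatched => /andP[].
rewrite /matching_weight size_rcons (perm_big _ (matched_pairs_add_pair piN ne)) big_cons /=.
rewrite letter_last letter_rcons // kE (inj_eq (@Some_inj _)) eq_sym mulN1r mulrC.
congr (_ * _); rewrite big_seq [RHS]big_seq; apply: eq_bigr => -[a b].
by rewrite mem_matched_pairs => /and4P[? ? ? _]; rewrite !letter_rcons //= -/n; lia.
Qed.

(** The right-hand side of [NC_sum_rcons] is one step of the stack of weight [-1] reading [j],
    the unmatched letters forming the stack, with the last one on top. *)
Lemma NC_sum_stack_count I l :
  \sum_(pi <- NC (size I))
     matching_weight I pi * stack_count (- 1 : A) l (rev (unmatched_word I pi)) =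
  stack_count (- 1) (I ++ l) [::].
Proof.
elim/last_ind: I l => [|I j IHI] l.
  rewrite big_seq_fset1 /matching_weight /unmatched_word /matched_pairs /= big_nil mul1r.
  by [].
rewrite (NC_sum_rcons (fun U => stack_count (- 1) l (rev U))) cat_rcons -IHI.
apply: eq_bigr => pi _; congr (_ * _); rewrite rev_rcons /=; congr (_ + _).
by case: (rev _) => // k U; rewrite revK mulN1r.
Qed.

End MatchingSums.

(** * Riemann-Stieltjes sums *)

Section RiemannStieltjes.
Variable R : realType.
Implicit Types (f g : R -> R) (a b : R) (s : seq R) (z : nat -> R).

Definition fine_tagged (delta a b : R) s z :=
  itv_partition a b s /\
  forall k, (k < size s)%N ->
    nth 0 (a :: s) k.+1 - nth 0 (a :: s) k < delta /\
    nth 0 (a :: s) k <= z k <= nth 0 (a :: s) k.+1.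

Definition real_RS_sum f g a s z : R :=
  \sum_(k < size s) (g (nth 0 (a :: s) k.+1) - g (nth 0 (a :: s) k)) * f (z k).

Definition has_RS_int f g a b w :=
  forall e : R, 0 < e -> exists2 delta : R, 0 < delta &
    forall s z, fine_tagged delta a b s z -> `|real_RS_sum f g a s z - w| < e.

Lemma itv_partition_telescope (h : R -> R) a b s : itv_partition a b s ->
  \sum_(k < size s) (h (nth 0 (a :: s) k.+1) - h (nth 0 (a :: s) k)) = h b - h a.
Proof.
move=> abs; rewrite -(big_mkord xpredT (fun k => h (nth 0 (a :: s) k.+1) - h (nth 0 (a :: s) k))).
by rewrite telescope_sumr //= (itv_partition_nth_size 0 abs).
Qed.

Lemma itv_partition_range a b s k : itv_partition a b s -> (k <= size s)%N ->
  a <= nth 0 (a :: s) k <= b.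
Proof.
move=> abs ks; rewrite (set_nth_default b) //.
by rewrite itv_partition_nth_ge ?itv_partition_nth_le.
Qed.

(** The definition of the integral only constrains it through such partitions: their existence is
    what makes it unique. *)
Lemma fine_partition_exists a b delta : a <= b -> 0 < delta ->
  exists s, fine_tagged delta a b s (nth 0 (a :: s)).
Proof.
move=> ab d0; have d20 : 0 < delta / 2 by rewrite divr_gt0.
suff H n : forall a, a <= b -> b - a < n%:R * (delta / 2) ->
    exists s, fine_tagged delta a b s (nth 0 (a :: s)).
  apply: (H (Num.bound ((b - a) / (delta / 2)))) => //.
  by rewrite -ltr_pdivrMr // archi_boundP // divr_ge0 ?subr_ge0 // ltW.
elim: n => [|n IHn] {ab} a ab; first by rewrite mul0r; lra.
move=> ban; have [d|d] := ltP (b - a) delta.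
  case: (eqVneq a b) => [ab'|ab'].
    by exists [::]; split=> //; split=> //=; rewrite ab'.
  have altb : a < b by rewrite lt_neqAle ab'.
  exists [:: b]; split; first exact: itv_partition1.
  by case=> //= _; rewrite lexx ltW.
have [||s [abs fs]] := IHn (a + delta / 2); [lra| |].
  by move: ban; rewrite -natr1 mulrDl mul1r; lra.
exists (a + delta / 2 :: s); split.
  case: abs => p1 p2; split=> //=; rewrite p1 andbT; lra.
by case=> [_|k ks] /=; [split; lra|apply: fs].
Qed.

Lemma has_RS_intD f1 f2 g a b w1 w2 : has_RS_int f1 g a b w1 -> has_RS_int f2 g a b w2 ->
  has_RS_int (fun u => f1 u + f2 u) g a b (w1 + w2).
Proof.
move=> h1 h2 e e0; have e20 : 0 < e / 2 by rewrite divr_gt0.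
have [d1 d10 {}h1] := h1 _ e20; have [d2 d20 {}h2] := h2 _ e20.
exists (Num.min d1 d2) => [|s z [abs sz]]; first by rewrite lt_min d10.
have /h1 {}h1 : fine_tagged d1 a b s z.
  by split=> // k /sz[]; rewrite lt_min => /andP[].
have /h2 {}h2 : fine_tagged d2 a b s z.
  by split=> // k /sz[]; rewrite lt_min => /andP[].
have -> : real_RS_sum (fun u => f1 u + f2 u) g a s z =
    real_RS_sum f1 g a s z + real_RS_sum f2 g a s z.
  by rewrite /real_RS_sum -big_split; apply: eq_bigr => k _ /=; rewrite mulrDr.
rewrite opprD addrACA (le_lt_trans (ler_normD _ _)) //; lra.
Qed.

Lemma has_RS_intZ c f g a b w : has_RS_int f g a b w ->
  has_RS_int (fun u => c * f u) g a b (c * w).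
Proof.
move=> h e e0; have c0 : 0 < `|c| + 1 by rewrite ltr_wpDl.
have [d d0 {}h] := h _ (divr_gt0 e0 c0); exists d => // s z /h {}h.
have -> : real_RS_sum (fun u => c * f u) g a s z = c * real_RS_sum f g a s z.
  by rewrite /real_RS_sum mulr_sumr; apply: eq_bigr => k _ /=; rewrite mulrCA.
rewrite -mulrBr normrM; move: h; rewrite ltr_pdivlMr // => h.
apply: le_lt_trans h; rewrite mulrC ler_wpM2l //; lra.
Qed.

Lemma eq_has_RS_int f1 f2 g a b w : (forall u, a <= u <= b -> f1 u = f2 u) ->
  has_RS_int f1 g a b w -> has_RS_int f2 g a b w.
Proof.
move=> f12 h e /h[d d0 {}h]; exists d => // s z sz; move: (h s z sz).
congr (`|_ - _| < _); apply: eq_bigr => k _; congr (_ * _); apply: f12.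
have [abs /(_ k (ltn_ord k))[_ /andP[z1 z2]]] := sz.
have /andP[a1 _] := itv_partition_range abs (ltnW (ltn_ord k)).
have /andP[_ b1] := itv_partition_range abs (ltn_ord k).
by rewrite (le_trans a1 z1) (le_trans z2 b1).
Qed.

Lemma has_RS_int0 g a b : has_RS_int (fun=> 0) g a b 0.
Proof.
move=> e e0; exists 1 => // s z _.
by rewrite /real_RS_sum big1 ?subr0 ?normr0 // => k _; rewrite mulr0.
Qed.

Lemma has_RS_int_level_sum (L : finType) n (f : seq L -> R -> R) g a b (w : seq L -> R) :
  (forall l, has_RS_int (f l) g a b (w l)) ->
  has_RS_int (fun u => level_sum n (fun l => f l u)) g a b (level_sum n w).
Proof.
elim: n f w => [|n IHn] f w fw /=; first exact: fw.
suff H (r : seq L) : has_RS_int (fun u => \sum_(i <- r) level_sum n (fun l => f (i :: l) u))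
    g a b (\sum_(i <- r) level_sum n (fun l => w (i :: l))) by exact: H.
elim: r => [|i r IHr].
  rewrite big_nil; apply: eq_has_RS_int (has_RS_int0 g a b) => u _.
  by rewrite big_nil.
rewrite big_cons; apply: eq_has_RS_int (has_RS_intD (IHn _ _ (fun l => fw (i :: l))) IHr).
by move=> u _; rewrite big_cons.
Qed.

Lemma has_RS_int_sum n (f : nat -> R -> R) g a b (w : nat -> R) :
  (forall k, has_RS_int (f k) g a b (w k)) ->
  has_RS_int (fun u => \sum_(k < n) f k u) g a b (\sum_(k < n) w k).
Proof.
move=> fw; elim: n => [|n IHn].
  rewrite big_ord0; apply: eq_has_RS_int (has_RS_int0 g a b) => u _.
  by rewrite big_ord0.
rewrite big_ord_recr /=; apply: eq_has_RS_int (has_RS_intD IHn (fw n)) => u _.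
by rewrite big_ord_recr.
Qed.

Lemma is_RS_int_unique (f : R -> R[i]) g a b u w : a <= b ->
  is_RS_int f g a b u -> is_RS_int f g a b w -> u = w.
Proof.
move=> ab fu fw; apply/eqP; rewrite -subr_eq0 -normr_eq0.
have : Normc.normc (u - w) <= 0.
  apply/ler_addgt0Pr => e e0; rewrite add0r.
  have e20 : 0 < e / 2 by rewrite divr_gt0.
  have [d1 d10 {}fu] := fu _ e20; have [d2 d20 {}fw] := fw _ e20.
  have [|s [abs sz]] := @fine_partition_exists a b (Num.min d1 d2) ab.
    by rewrite lt_min d10.
  have lt1 : `|RS_sum f g a s (nth 0 (a :: s)) - u| < (e / 2)%:C%C.
    by apply: fu abs _ => k /sz[]; rewrite lt_min => /andP[].
  have lt2 : `|RS_sum f g a s (nth 0 (a :: s)) - w| < (e / 2)%:C%C.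
    by apply: fw abs _ => k /sz[]; rewrite lt_min => /andP[].
  rewrite -lecR; apply: ltW.
  have -> : e = e / 2 + e / 2 by lra.
  rewrite rmorphD; apply: le_lt_trans (ltrD lt1 lt2).
  rewrite -[leLHS]/(`|u - w|) -[X in `|X| + _]opprK normrN opprB.
  by apply: le_trans (ler_normD _ _); rewrite addrA subrK.
rewrite -lecR => h; rewrite eq_le normr_ge0 andbT; exact: h.
Qed.

Lemma RS_intE (f : R -> R[i]) g a b w : a <= b -> is_RS_int f g a b w ->
  RS_int f g a b = w.
Proof.
move=> ab fw; rewrite /RS_int; apply: (is_RS_int_unique ab _ fw).
by case: xgetP => [x -> //|/(_ w) /(_ fw)].
Qed.

Lemma eq_RS_int (f1 f2 : R -> R[i]) g a b : (forall u, a <= u <= b -> f1 u = f2 u) ->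
  RS_int f1 g a b = RS_int f2 g a b.
Proof.
move=> f12; rewrite /RS_int; congr xget; apply/funext => w; apply/propext.
suff H h1 h2 : (forall u, a <= u <= b -> h1 u = h2 u) ->
    is_RS_int h1 g a b w -> is_RS_int h2 g a b w.
  by split; apply: H => // u ab; rewrite f12.
move=> h12 h e /h[d d0 {}h]; exists d => // s z abs sz.
rewrite -(_ : RS_sum h1 g a s z = RS_sum h2 g a s z); first exact: h.
apply: eq_bigr => k _; congr (_ * _); apply: h12.
have [_ /andP[z1 z2]] := sz k (ltn_ord k).
have /andP[a1 _] := itv_partition_range abs (ltnW (ltn_ord k)).
have /andP[_ b1] := itv_partition_range abs (ltn_ord k).
by rewrite (le_trans a1 z1) (le_trans z2 b1).
Qed.

(** No integrability is assumed: for [c] nonzero the two integrals exist or not together, and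
    they take the default value [0] in the second case. *)
Lemma RS_intMr (f : R -> R[i]) g a b c : a <= b ->
  RS_int (fun u => f u * c) g a b = RS_int f g a b * c.
Proof.
move=> ab.
have scale (h : R -> R[i]) c' w : is_RS_int h g a b w ->
    is_RS_int (fun u => h u * c') g a b (w * c').
  move=> hw e e0; have c0 : 0 < Normc.normc c' + 1.
    by rewrite ltr_wpDl // -lecR; exact: (normr_ge0 c').
  have [d d0 {}h1] := hw _ (divr_gt0 e0 c0); exists d => // s z abs sz.
  have {}h1 := h1 s z abs sz.
  have -> : RS_sum (fun u => h u * c') g a s z = RS_sum h g a s z * c'.
    by rewrite /RS_sum mulr_suml; apply: eq_bigr => k _ /=; rewrite mulrA.
  rewrite -mulrBl normrM.
  have -> : e%:C%C = (e / (Normc.normc c' + 1))%:C%C * (Normc.normc c' + 1)%:C%C :> R[i].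
    by rewrite -rmorphM /= divfK // gt_eqF.
  apply: (@le_lt_trans _ _ (`|RS_sum h g a s z - w| * (Normc.normc c' + 1)%:C%C)).
    by rewrite ler_wpM2l // lecR; lra.
  by rewrite ltr_pM2r // ltcR.
have [->|c0] := eqVneq c 0.
  rewrite mulr0; apply: RS_intE => // e e0; exists 1 => // s z _ _.
  by rewrite /RS_sum big1 ?subr0 ?normr0 ?ltcR // => k _; rewrite !mulr0.
have [[w fw]|nex] := pselect (exists w, is_RS_int f g a b w).
  by rewrite (RS_intE ab fw); apply: RS_intE => //; apply: scale.
rewrite {2}/RS_int xgetPN ?mul0r; last by move=> w fw; apply: nex; exists w.
rewrite /RS_int xgetPN // => w fw; apply: nex; exists (w * c^-1).
have := scale _ c^-1 _ fw; congr (is_RS_int _ _ _ _ _).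
by apply/funext => u; rewrite mulfK.
Qed.

Lemma real_RS_intE f g a b w : a <= b -> has_RS_int f g a b w ->
  RS_int (fun u => (f u)%:C%C) g a b = w%:C%C.
Proof.
move=> ab fw; apply: RS_intE => // e /fw[d d0 {}fw]; exists d => // s z abs sz.
have -> : RS_sum (fun u => (f u)%:C%C) g a s z = (real_RS_sum f g a s z)%:C%C.
  by rewrite rmorph_sum; apply: eq_bigr => k _; rewrite rmorphM.
by rewrite -rmorphB normc_def /= expr0n /= addr0 sqrtr_sqr ltcR; apply: fw.
Qed.

End RiemannStieltjes.

(** * Integrals of functions controlled by a continuous increasing function *)

Section Control.
Variables (R : realType) (T : R) (v : R -> R).

Hypothesis v_homo : forall x y, 0 <= x -> x <= y -> y <= T -> v x <= v y.
Hypothesis v_unif : forall e, 0 < e -> exists2 delta, 0 < delta &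
  forall x y, 0 <= x -> x <= y -> y <= T -> y - x < delta -> v y - v x < e.

(** Lipschitz continuity on [[a, b]] with respect to the control [v] instead of the length. *)
Definition vlip (A : R) (f : R -> R) (a b : R) :=
  forall x y, a <= x -> x <= y -> y <= b -> `|f y - f x| <= A * (v y - v x).

(** Cutting [[a, b]] into pieces over which [v] grows by less than [e], the increments of [H] add
    up to at most [C * e * (v b - v a)]. *)
Lemma le_of_quadratic C (H : R -> R) a b : 0 <= a -> a <= b -> b <= T -> 0 <= C ->
  (forall x y, a <= x -> x <= y -> y <= b -> H y - H x <= C * (v y - v x) ^+ 2) ->
  H b <= H a.
Proof.
move=> a0 ab bT C0 HC; apply/ler_addgt0Pr => e e0.
have V0 : 0 <= v b - v a by rewrite subr_ge0 v_homo.
have CV0 : 0 < C * (v b - v a) + 1 by rewrite ltr_wpDl // mulr_ge0.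
have [delta d0 vd] := v_unif (divr_gt0 e0 CV0).
set e1 := e / _ in vd.
have e10 : 0 < e1 by apply: divr_gt0.
have d20 : 0 < delta / 2 by rewrite divr_gt0.
have step x y : a <= x -> x <= y -> y <= b -> y - x < delta ->
    H y - H x <= C * e1 * (v y - v x).
  move=> ax xy yb xyd; apply: le_trans (HC _ _ ax xy yb) _.
  have vxy : v y - v x < e1 by apply: vd; lra.
  have vxy0 : 0 <= v y - v x by rewrite subr_ge0 v_homo //; lra.
  rewrite expr2 mulrA ler_wpM2r // ler_wpM2l //; exact: ltW.
(* Steps of length [delta / 2] leave room for a last piece of length less than [delta]. *)
have steps n : forall x, a <= x -> x <= b -> b - x < n%:R * (delta / 2) ->
    H b - H x <= C * e1 * (v b - v x).
  elim: n => [|n IHn] x ax xb; first by rewrite mul0r; lra.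
  rewrite -natr1 mulrDl mul1r => xbn.
  have [d|d] := ltP (b - x) delta; first exact: step.
  have h1 : H (x + delta / 2) - H x <= C * e1 * (v (x + delta / 2) - v x).
    by apply: step; lra.
  have h2 : H b - H (x + delta / 2) <= C * e1 * (v b - v (x + delta / 2)).
    by apply: IHn; lra.
  have -> : C * e1 * (v b - v x) =
    C * e1 * (v (x + delta / 2) - v x) + C * e1 * (v b - v (x + delta / 2)) by ring.
  by rewrite (le_trans _ (lerD h1 h2)) //; lra.
have h : H b - H a <= C * e1 * (v b - v a).
  apply: (steps (Num.bound ((b - a) / (delta / 2)))) => //.
  by rewrite -ltr_pdivrMr // archi_boundP // divr_ge0 ?subr_ge0 // ltW.
rewrite -lerBlDl; apply: le_trans h _.
rewrite mulrAC /e1 mulrA ler_pdivrMr // mulrC ler_wpM2l ?(ltW e0) //; lra.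
Qed.

Lemma abs_le_of_quadratic C (H G : R -> R) a b : 0 <= a -> a <= b -> b <= T -> 0 <= C ->
  (forall x y, a <= x -> x <= y -> y <= b ->
     `|H y - H x| <= G y - G x + C * (v y - v x) ^+ 2) ->
  `|H b - H a| <= G b - G a.
Proof.
move=> a0 ab bT C0 HG; rewrite ler_norml; apply/andP; split.
  suff : - H b - G b <= - H a - G a by lra.
  apply: (le_of_quadratic (H := fun x => - H x - G x) a0 ab bT C0) => x y ax xy yb.
  by have := HG _ _ ax xy yb; rewrite ler_norml => /andP[]; lra.
suff : H b - G b <= H a - G a by lra.
apply: (le_of_quadratic (H := fun x => H x - G x) a0 ab bT C0) => x y ax xy yb.
by have := HG _ _ ax xy yb; rewrite ler_norml => /andP[]; lra.
Qed.

Section Existence.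
Variables (f g : R -> R) (A a b : R).
Hypotheses (a0 : 0 <= a) (ab : a <= b) (bT : b <= T) (A0 : 0 <= A).
Hypotheses (f_lip : vlip A f a b) (g_lip : vlip 1 g a b).

(** The term of second order is chosen to dominate the change of [f x * (g y - g x)] when a point
    is inserted between [x] and [y] (see [cross_le]). Hence refining a partition increases the
    sums of [lower] and decreases those of [upper], as for Darboux sums. *)
Let lower x y := f x * (g y - g x) - A * (v y - v x) ^+ 2.
Let upper x y := f x * (g y - g x) + A * (v y - v x) ^+ 2.

(** [lower_chain y r] holds if [r] is the sum of [lower] over the intervals of a partition of
    [[a, y]]. *)
Inductive lower_chain : R -> R -> Prop :=
| lower_chain0 : lower_chain a 0
| lower_chainS x y r : lower_chain x r -> x <= y -> y <= b ->
    lower_chain y (r + lower x y).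

Lemma lower_chain_range y r : lower_chain y r -> a <= y <= b.
Proof.
by elim=> [|x z {}r _ /andP[ax xb] xz zb]; rewrite ?lexx ?zb ?(le_trans ax).
Qed.

Lemma lower_le_upper x y : a <= x -> x <= y -> y <= b -> lower x y <= upper x y.
Proof.
move=> ax xy yb; rewrite /lower /upper.
by have := mulr_ge0 A0 (sqr_ge0 (v y - v x)); lra.
Qed.

Lemma cross_le x z y : a <= x -> x <= z -> z <= y -> y <= b ->
  `|(f z - f x) * (g y - g z)| <= A * ((v z - v x) * (v y - v z)).
Proof.
move=> ax xz zy yb; rewrite normrM mulrA ler_pM // ?f_lip //; first lra.
by have := @g_lip z y; rewrite mul1r; apply; lra.
Qed.

Lemma v_incr_ge0 x y : a <= x -> x <= y -> y <= b -> 0 <= v y - v x.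
Proof.
by move=> ax xy yb; rewrite subr_ge0 v_homo ?(le_trans a0 ax) ?(le_trans yb bT).
Qed.

Lemma lower_refine x z y : a <= x -> x <= z -> z <= y -> y <= b ->
  lower x y <= lower x z + lower z y.
Proof.
move=> ax xz zy yb; have := cross_le ax xz zy yb; rewrite ler_norml => /andP[c1 c2].
have h : 0 <= A * ((v z - v x) * (v y - v z)).
  by rewrite !mulr_ge0 // v_incr_ge0 //; lra.
rewrite /lower -subr_ge0.
have -> : f x * (g z - g x) - A * (v z - v x) ^+ 2 + (f z * (g y - g z) -
   A * (v y - v z) ^+ 2) - (f x * (g y - g x) - A * (v y - v x) ^+ 2) =
   (f z - f x) * (g y - g z) + 2 * (A * ((v z - v x) * (v y - v z))) by ring.
lra.
Qed.

Lemma upper_refine x z y : a <= x -> x <= z -> z <= y -> y <= b ->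
  upper x z + upper z y <= upper x y.
Proof.
move=> ax xz zy yb; have := cross_le ax xz zy yb; rewrite ler_norml => /andP[c1 c2].
have h : 0 <= A * ((v z - v x) * (v y - v z)).
  by rewrite !mulr_ge0 // v_incr_ge0 //; lra.
rewrite /upper -subr_ge0.
have -> : f x * (g y - g x) + A * (v y - v x) ^+ 2 - (f x * (g z - g x) +
   A * (v z - v x) ^+ 2 + (f z * (g y - g z) + A * (v y - v z) ^+ 2)) =
   2 * (A * ((v z - v x) * (v y - v z))) - (f z - f x) * (g y - g z) by ring.
lra.
Qed.

(** The point [x] is inserted in the partition; by [upper_refine] the part of the sum beyond [x]
    is at most [upper x y]. *)
Lemma lower_chain_insert y r : lower_chain y r -> forall x, a <= x -> x <= y ->
  exists2 r1, lower_chain x r1 & r <= r1 + upper x y.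
Proof.
elim=> [|w {}y {}r ch IH wy yb] x ax xy.
  have -> : x = a by apply/eqP; rewrite eq_le ax xy.
  by exists 0; [constructor|rewrite /upper !subrr expr0n /= !mulr0 !addr0].
have /andP[aw wb] := lower_chain_range ch.
have [xw|wx] := leP x w.
  have [r1 ch1 rr1] := IH _ ax xw; exists r1 => //.
  have := upper_refine ax xw wy yb; have := lower_le_upper aw wy yb; lra.
exists (r + lower w x).
  by apply: lower_chainS => //; [exact: ltW|lra].
have := lower_refine aw (ltW wx) xy yb; have := lower_le_upper ax xy yb; lra.
Qed.

(** The primitive is the supremum of the sums of [lower] over the partitions of [[a, y]].
    Appending a cell to a partition of [[a, x]] bounds its increment from below by [lower], and
    inserting [x] in a partition of [[a, y]] bounds it from above by [upper]. *)
Lemma primitive_exists : exists F : R -> R, forall x y,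
  a <= x -> x <= y -> y <= b ->
  `|F y - F x - f x * (g y - g x)| <= A * (v y - v x) ^+ 2.
Proof.
pose E y : set R := lower_chain y.
exists (fun y => sup (E y)) => x y ax xy yb.
have chain_at z : a <= z -> z <= b -> lower_chain z (0 + lower a z).
  by move=> az zb; apply: lower_chainS => //; constructor.
have ubE z : a <= z -> z <= b -> has_ubound (E z).
  move=> _ _; exists (upper a z) => r; elim=> [|w {}z {}r ch IH wz zb].
    by rewrite /upper !subrr expr0n /= !mulr0 addr0.
  have /andP[aw wb] := lower_chain_range ch.
  by have := upper_refine (lexx a) aw wz zb; have := lower_le_upper aw wz zb; lra.
have supE z : a <= z -> z <= b -> has_sup (E z).
  by move=> az zb; split; [exists (0 + lower a z); apply: chain_at|apply: ubE].
have ay := le_trans ax xy; have xb := le_trans xy yb.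
have low : sup (E x) <= sup (E y) - lower x y.
  apply: ge_sup; first exact: (supE x _ _).1.
  move=> r ch; rewrite lerBrDr; apply: ub_le_sup; first exact: ubE.
  exact: lower_chainS.
have upp : sup (E y) <= sup (E x) + upper x y.
  apply: ge_sup; first exact: (supE y _ _).1.
  move=> r ch; have [r1 ch1 rr1] := lower_chain_insert ch ax xy.
  by apply: le_trans rr1 _; rewrite lerD2r; apply: ub_le_sup => //; apply: ubE.
rewrite ler_norml; move: low upp; rewrite /lower /upper; lra.
Qed.

End Existence.

(** Over a cell with tag [t], replacing [f t] by [f x] costs one more error of second order, and
    the total error is at most the largest increment of [v] times a constant. *)
Lemma has_RS_int_primitive f g F A a b : 0 <= a -> a <= b -> b <= T -> 0 <= A ->
  vlip A f a b -> vlip 1 g a b ->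
  (forall x y, a <= x -> x <= y -> y <= b ->
     `|F y - F x - f x * (g y - g x)| <= A * (v y - v x) ^+ 2) ->
  has_RS_int f g a b (F b - F a).
Proof.
move=> a0 ab bT A0 fA g1 FA e e0.
have V0 : 0 <= v b - v a by rewrite subr_ge0 v_homo.
have CV0 : 0 < 2 * A * (v b - v a) + 1 by rewrite ltr_wpDl // !mulr_ge0.
have [delta d0 vd] := v_unif (divr_gt0 e0 CV0); exists delta => // s z [abs sz].
set e1 := e / _ in vd.
have e10 : 0 < e1 by apply: divr_gt0.
apply: (@le_lt_trans _ _ (2 * A * e1 * (v b - v a))); last first.
  rewrite mulrAC /e1 mulrA ltr_pdivrMr // mulrC ltr_pM2l //; lra.
rewrite -(itv_partition_telescope F abs) -(itv_partition_telescope v abs) -sumrB mulr_sumr.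
apply: (le_trans (ler_norm_sum _ _ _)); apply: ler_sum => k _.
have [gap /andP[z1 z2]] := sz k (ltn_ord k).
have /andP[ax xb] := itv_partition_range abs (ltnW (ltn_ord k)).
have /andP[ay yb] := itv_partition_range abs (ltn_ord k).
move: gap z1 z2 ax xb ay yb; rewrite /=.
set x := nth 0 (a :: s) k; set y := nth 0 s k; move: (z k) => t gap xt ty ax xb ay yb.
have xy := le_trans xt ty.
have vxy0 : 0 <= v y - v x by rewrite subr_ge0 v_homo //; lra.
have vxt0 : 0 <= v t - v x by rewrite subr_ge0 v_homo //; lra.
have vty0 : 0 <= v y - v t by rewrite subr_ge0 v_homo //; lra.
have vxy : v y - v x < e1 by apply: vd => //; lra.
have h1 := FA _ _ ax xy yb.
have h2 : `|f t - f x| <= A * (v t - v x) by apply: fA; lra.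
have h3 : `|g y - g x| <= v y - v x by have := g1 _ _ ax xy yb; rewrite mul1r.
have -> : (g y - g x) * f t - (F y - F x) =
   (f t - f x) * (g y - g x) - (F y - F x - f x * (g y - g x)) by ring.
apply: le_trans (ler_normB _ _) _.
have h4 : `|(f t - f x) * (g y - g x)| <= A * (v y - v x) ^+ 2.
  rewrite normrM expr2 mulrA ler_pM //.
  by apply: le_trans h2 _; rewrite ler_wpM2l //; lra.
apply: le_trans (lerD h4 h1) _.
have -> : A * (v y - v x) ^+ 2 + A * (v y - v x) ^+ 2 =
   2 * A * (v y - v x) * (v y - v x) by ring.
by rewrite ler_wpM2r // ler_wpM2l ?mulr_ge0 // ltW.
Qed.

(** The real part makes this a total function with values in the reals; for the integrands below
    it is the integral itself ([integral_ofC]). *)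
Definition integral_of f g a b : R := complex.Re (RS_int (fun u => (f u)%:C%C) g a b).

Lemma integral_of_eq f g a b w : a <= b -> has_RS_int f g a b w -> integral_of f g a b = w.
Proof. by move=> ab fw; rewrite /integral_of (real_RS_intE ab fw). Qed.

Lemma eq_integral_of f1 f2 g a b : (forall u, a <= u <= b -> f1 u = f2 u) ->
  integral_of f1 g a b = integral_of f2 g a b.
Proof.
by move=> f12; rewrite /integral_of (@eq_RS_int _ _ (fun u => (f2 u)%:C%C)) // => u /f12->.
Qed.

Lemma integral_ofxx f g a : integral_of f g a a = 0.
Proof.
apply: integral_of_eq => // e e0; exists 1 => // s z [/itv_partitionxx -> _].
by rewrite /real_RS_sum big_ord0 subr0 normr0.
Qed.

Section IntegralTheory.
Variables (g : R -> R).

Lemma vlipW A f a b x y : a <= x -> y <= b -> vlip A f a b -> vlip A f x y.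
Proof. by move=> ax yb fA z t xz zt ty; apply: fA => //; lra. Qed.

Lemma integral_of_primitive f A a b : 0 <= a -> a <= b -> b <= T -> 0 <= A ->
  vlip A f a b -> vlip 1 g a b ->
  exists2 F : R -> R,
    forall x y, a <= x -> x <= y -> y <= b ->
      has_RS_int f g x y (F y - F x) /\ integral_of f g x y = F y - F x
  & forall x y, a <= x -> x <= y -> y <= b ->
      `|F y - F x - f x * (g y - g x)| <= A * (v y - v x) ^+ 2.
Proof.
move=> a0 ab bT A0 fA g1; have [F FA] := primitive_exists a0 ab bT A0 fA g1.
exists F => // x y ax xy yb.
have fF : has_RS_int f g x y (F y - F x).
  apply: (has_RS_int_primitive _ _ _ A0) => //; try lra.
  - exact: vlipW fA.
  - exact: vlipW g1.
  - by move=> z t xz zt ty; apply: FA; lra.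
by split=> //; apply: integral_of_eq.
Qed.

Section Bounds.
Variables (f : R -> R) (A a b : R).
Hypotheses (a0 : 0 <= a) (ab : a <= b) (bT : b <= T) (A0 : 0 <= A).
Hypotheses (fA : vlip A f a b) (g1 : vlip 1 g a b).

Lemma has_integral_of : has_RS_int f g a b (integral_of f g a b).
Proof.
have [F hF _] := integral_of_primitive a0 ab bT A0 fA g1.
by have [h ->] := hF _ _ (lexx a) ab (lexx b).
Qed.

Lemma integral_ofC : RS_int (fun u => (f u)%:C%C) g a b = (integral_of f g a b)%:C%C.
Proof. exact: real_RS_intE has_integral_of. Qed.

Lemma integral_of_chasles c : a <= c -> c <= b ->
  integral_of f g a b = integral_of f g a c + integral_of f g c b.
Proof.
have [F hF _] := integral_of_primitive a0 ab bT A0 fA g1.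
move=> ac cb; have [_ ->] := hF _ _ (lexx a) ab (lexx b).
have [_ ->] := hF _ _ (lexx a) ac cb.
by have [_ ->] := hF _ _ ac cb (lexx b); ring.
Qed.

Lemma integral_of_local x y : a <= x -> x <= y -> y <= b ->
  `|integral_of f g x y - f x * (g y - g x)| <= A * (v y - v x) ^+ 2.
Proof.
have [F hF FA] := integral_of_primitive a0 ab bT A0 fA g1.
by move=> ax xy yb; have [_ ->] := hF _ _ ax xy yb; apply: FA.
Qed.

(** Two functions with the same increments up to the second order differ by a constant. *)
Lemma integral_of_unique C (G : R -> R) : 0 <= C ->
  (forall x y, a <= x -> x <= y -> y <= b ->
     `|G y - G x - f x * (g y - g x)| <= C * (v y - v x) ^+ 2) ->
  integral_of f g a b = G b - G a.
Proof.
move=> C0 GC; have [F hF FA] := integral_of_primitive a0 ab bT A0 fA g1.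
have [_ ->] := hF _ _ (lexx a) ab (lexx b).
apply/eqP; rewrite -subr_eq0 -normr_le0.
have -> : F b - F a - (G b - G a) = (F b - G b) - (F a - G a) by ring.
rewrite -[leRHS](subrr 0).
apply: (abs_le_of_quadratic (H := fun x => F x - G x) (G := fun=> 0) (C := A + C)) => //.
  exact: addr_ge0.
move=> x y ax xy yb; rewrite subrr add0r mulrDl.
have -> : F y - G y - (F x - G x) = (F y - F x - f x * (g y - g x)) -
   (G y - G x - f x * (g y - g x)) by ring.
by apply: le_trans (ler_normB _ _) _; rewrite lerD ?FA ?GC.
Qed.

(** This is the comparison with the integral of [`|f|] with respect to [v], when a primitive [G]
    of the latter, or a majorant of it, is known. *)
Lemma integral_of_bound (G : R -> R) :
  (forall x y, a <= x -> x <= y -> y <= b -> `|f x| * (v y - v x) <= G y - G x) ->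
  `|integral_of f g a b| <= G b - G a.
Proof.
move=> fG; have [F hF FA] := integral_of_primitive a0 ab bT A0 fA g1.
have [_ ->] := hF _ _ (lexx a) ab (lexx b).
apply: (abs_le_of_quadratic (C := A)) => // x y ax xy yb.
rewrite -lerBlDr (le_trans _ (fG _ _ ax xy yb)) // lerBlDr.
have h3 : `|g y - g x| <= v y - v x by have := g1 ax xy yb; rewrite mul1r.
apply: le_trans (lerD (ler_wpM2l (normr_ge0 (f x)) h3) (FA _ _ ax xy yb)).
by rewrite -normrM; apply: le_trans (ler_normD _ _); rewrite [leRHS](_ : _ = `|F y - F x|) //;
  congr `|_|; ring.
Qed.

End Bounds.
End IntegralTheory.
End Control.

(** * Signatures as controlled paths *)

Section Signature.
Variables (R : realType) (T : R) (v : R -> R).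

Hypothesis v_homo : forall x y, 0 <= x -> x <= y -> y <= T -> v x <= v y.
Hypothesis v_unif : forall e, 0 < e -> exists2 delta, 0 < delta &
  forall x y, 0 <= x -> x <= y -> y <= T -> y - x < delta -> v y - v x < e.

Variables (L : Type) (g : L -> R -> R).
Hypothesis g_lip : forall j, vlip v 1 (g j) 0 T.

Let V : R := v T - v 0.

Lemma incr_bounds x y : 0 <= x -> x <= y -> y <= T -> 0 <= v y - v x <= V.
Proof.
move=> x0 xy yT; rewrite /V subr_ge0 v_homo //=; apply: lerB; apply: v_homo => //.
  exact: le_trans xy.
exact: le_trans yT.
Qed.

Lemma g_vlip j a b : 0 <= a -> b <= T -> vlip v 1 (g j) a b.
Proof. by move=> a0 bT; apply: vlipW (@g_lip j). Qed.

(** The signature over the reversed word, the last integration being the outermost. *)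
Fixpoint real_sig (l : seq L) (s t : R) : R :=
  if l is j :: l' then integral_of (real_sig l' s) (g j) s t else 1.

Lemma real_RS_sum_le f j M a b delta s z : 0 <= a -> b <= T ->
  (forall x, a <= x <= b -> `|f x| <= M) -> fine_tagged delta a b s z ->
  `|real_RS_sum f (g j) a s z| <= M * (v b - v a).
Proof.
move=> a0 bT fM [abs sz]; rewrite -(itv_partition_telescope v abs) mulr_sumr.
apply: (le_trans (ler_norm_sum _ _ _)); apply: ler_sum => k _.
have [_ /andP[xz zy]] := sz k (ltn_ord k).
have /andP[ax _] := itv_partition_range abs (ltnW (ltn_ord k)).
have /andP[_ yb] := itv_partition_range abs (ltn_ord k).
rewrite normrM mulrC; apply: ler_pM => //.
  by apply: fM; rewrite (le_trans ax xz) (le_trans zy yb).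
by have := @g_vlip j a b a0 bT _ _ ax (le_trans xz zy) yb; rewrite mul1r.
Qed.

Lemma has_RS_int_le f j M a b w : 0 <= a -> a <= b -> b <= T ->
  (forall x, a <= x <= b -> `|f x| <= M) -> has_RS_int f (g j) a b w ->
  `|w| <= M * (v b - v a).
Proof.
move=> a0 ab bT fM fw; apply/ler_addgt0Pr => e /fw[delta d0 {}fw].
have [s sf] := fine_partition_exists ab d0.
have {}fw := fw _ _ sf; have h := real_RS_sum_le j a0 bT fM sf.
rewrite -(subrK (real_RS_sum f (g j) a s (nth 0 (a :: s))) w).
by apply: le_trans (ler_normD _ _) _; rewrite distrC addrC; apply: lerD h (ltW fw).
Qed.

(** Term by term integration. The geometric rate [2^-1 ^+ n] is the one at which all the series
    below converge. *)
Lemma has_RS_int_limit f j C a b w : 0 <= a -> a <= b -> b <= T -> 0 <= C ->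
  (forall n, exists f' w', [/\ has_RS_int f' (g j) a b w',
     forall u, a <= u <= b -> `|f u - f' u| <= C * 2^-1 ^+ n
     & `|w' - w| <= C * 2^-1 ^+ n]) ->
  has_RS_int f (g j) a b w.
Proof.
move=> a0 ab bT C0 fn e e0.
have V1 : 0 < v b - v a + 1 by rewrite ltr_wpDl // subr_ge0 v_homo.
have e20 : 0 < e / 2 by rewrite divr_gt0.
have [n nP] : exists n, C * 2^-1 ^+ n * (v b - v a + 1) < e / 2.
  exists (Num.bound (C * (v b - v a + 1) / (e / 2))); set n := Num.bound _.
  have n2 : C * (v b - v a + 1) / (e / 2) < 2 ^+ n.
    apply: (@lt_trans _ _ n%:R).
      by apply: archi_boundP; rewrite divr_ge0 ?mulr_ge0 // ltW.
    by rewrite -natrX ltr_nat ltn_expl.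
  by rewrite exprVn mulrAC ltr_pdivrMr ?exprn_gt0 // [ltRHS]mulrC -ltr_pdivrMr.
have [f' [w' [fw' ff' ww']]] := fn n.
have [delta d0 {}fw'] := fw' _ e20; exists delta => // s z sz.
have {}fw' := fw' s z sz.
have h : `|real_RS_sum (fun u => f u - f' u) (g j) a s z| <=
    C * 2^-1 ^+ n * (v b - v a) by apply: real_RS_sum_le sz.
have E : real_RS_sum (fun u => f u - f' u) (g j) a s z =
    real_RS_sum f (g j) a s z - real_RS_sum f' (g j) a s z.
  by rewrite /real_RS_sum -sumrB; apply: eq_bigr => k _; rewrite mulrBr.
rewrite E in h; rewrite mulrDr mulr1 in nP.
move: h fw' ww' nP; rewrite !ler_norml !ltr_norml; lra.
Qed.

(** One constant for a bound, and for the Lipschitz continuity in the second and in the first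
    variable. In the first variable the increment splits into the integral of the increment of
    the inner signature over [[x, y]] and an integral over the short interval [[s, x]]. *)
Lemma real_sig_regular l : exists2 C, 0 <= C & forall s x y,
  0 <= s -> s <= x -> x <= y -> y <= T ->
  [/\ `|real_sig l s y| <= C,
      `|real_sig l s y - real_sig l s x| <= C * (v y - v x)
    & `|real_sig l x y - real_sig l s y| <= C * (v x - v s)].
Proof.
elim: l => [|j l [C C0 IH]].
  exists 1 => // s x y s0 sx xy yT /=; rewrite !subrr normr1 normr0 !mul1r !subr_ge0.
  by split=> //; apply: v_homo => //; lra.
have lipl s : 0 <= s -> vlip v C (real_sig l s) s T.
  by move=> s0 x y sx xy yT; have [] := IH _ _ _ s0 sx xy yT.
have hasl s a b : 0 <= s -> s <= a -> a <= b -> b <= T ->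
    has_RS_int (real_sig l s) (g j) a b (integral_of (real_sig l s) (g j) a b).
  move=> s0 sa ab bT; apply: (has_integral_of v_homo v_unif (A := C)) => //; first lra.
    exact: vlipW (lipl _ s0).
  by apply: g_vlip => //; lra.
have chas s x y : 0 <= s -> s <= x -> x <= y -> y <= T -> real_sig (j :: l) s y =
    real_sig (j :: l) s x + integral_of (real_sig l s) (g j) x y.
  move=> s0 sx xy yT; apply: (integral_of_chasles v_homo v_unif (A := C)) => //; first lra.
    exact: vlipW (lipl _ s0).
  exact: g_vlip.
have small s x y : 0 <= s -> s <= x -> x <= y -> y <= T ->
    `|integral_of (real_sig l s) (g j) x y| <= C * (v y - v x).
  move=> s0 sx xy yT; apply: has_RS_int_le (hasl _ _ _ s0 sx xy yT) => //; first lra.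
  move=> z /andP[xz zy]; have zT : z <= T by lra.
  have sz : s <= z by lra.
  by have [] := IH _ _ _ s0 sz (lexx z) zT.
have V0 s : 0 <= s -> s <= T -> 0 <= V.
  by move=> s0 sT; have /andP[] := incr_bounds s0 sT (lexx T); apply: le_trans.
exists (C + C * `|V|) => [|s x y s0 sx xy yT]; first by rewrite addr_ge0 ?mulr_ge0.
have sT : s <= T by lra.
rewrite (ger0_norm (V0 _ s0 sT)).
have sy : s <= y by lra.
have /andP[vsy1 vsy2] := incr_bounds s0 sy yT.
have /andP[vxy1 vxy2] : 0 <= v y - v x <= V by apply: incr_bounds => //; lra.
have /andP[vsx1 vsx2] : 0 <= v x - v s <= V by apply: incr_bounds => //; lra.
have CV0 : 0 <= C * V by rewrite mulr_ge0 // (V0 _ s0 sT).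
split.
- apply: le_trans (small _ _ _ s0 (lexx s) sy yT) _.
  have : C * (v y - v s) <= C * V by apply: ler_wpM2l.
  lra.
- rewrite (chas s x y) // addrAC subrr add0r.
  apply: le_trans (small _ _ _ s0 sx xy yT) _.
  by rewrite ler_wpM2r //; lra.
- rewrite (chas s x y) // opprD addrCA addrC.
  have xx : x <= x by [].
  have x0 : 0 <= x by lra.
  rewrite (_ : real_sig (j :: l) x y = integral_of (real_sig l x) (g j) x y) //.
  have hB := has_RS_intD (hasl _ _ _ x0 xx xy yT) (has_RS_intZ (-1) (hasl _ _ _ s0 sx xy yT)).
  have h1 : `|integral_of (real_sig l x) (g j) x y +
      -1 * integral_of (real_sig l s) (g j) x y| <= C * (v x - v s) * (v y - v x).
    apply: has_RS_int_le hB => // z /andP[xz zy]; rewrite mulN1r.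
    have zT : z <= T by lra.
    by have [] := IH _ _ _ s0 sx xz zT.
  rewrite mulN1r in h1; apply: le_trans (ler_normD _ _) _; rewrite normrN.
  apply: le_trans (lerD h1 (small _ _ _ s0 (lexx s) sx (le_trans xy yT))) _.
  rewrite mulrDl addrC lerD2l -mulrA [in leRHS]mulrAC -mulrA ler_wpM2l // ler_wpM2l //.
Qed.

Lemma real_sig_vlip l : exists2 C, 0 <= C &
  forall s a b, 0 <= s -> s <= a -> b <= T -> vlip v C (real_sig l s) a b.
Proof.
have [C C0 CP] := real_sig_regular l; exists C => // s a b s0 sa bT x y ax xy yb.
by have [||//] := CP s x y s0 _ xy; lra.
Qed.

Lemma real_sig_chasles j l s x y : 0 <= s -> s <= x -> x <= y -> y <= T ->
  real_sig (j :: l) s y = real_sig (j :: l) s x + integral_of (real_sig l s) (g j) x y.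
Proof.
move=> s0 sx xy yT; have [C C0 CP] := real_sig_vlip l.
apply: (integral_of_chasles v_homo v_unif (A := C)) => //; first lra.
  exact: CP.
exact: g_vlip.
Qed.

(** The iterated integrals of the exponential [expR (lambda * v)] with respect to [v] gain a
    factor [lambda^-1] each; this takes the place of the usual bound with factorials, and provides
    any geometric rate. *)
Lemma real_sig_exp_bound lambda l s t : 0 < lambda -> 0 <= s -> s <= t -> t <= T ->
  `|real_sig l s t| <= lambda^-1 ^+ size l * expR (lambda * (v t - v s)).
Proof.
move=> lam0; elim: l t => [|j l IHl] t s0 st tT /=.
  rewrite expr0 mul1r normr1 -expR0 ler_expR mulr_ge0 ?(ltW lam0) //.
  by rewrite subr_ge0 v_homo.
have [C C0 CP] := real_sig_vlip l.
pose G x := lambda^-1 ^+ (size l).+1 * expR (lambda * (v x - v s)).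
apply: (@le_trans _ _ (G t - G s)); last first.
  by rewrite gerBl mulr_ge0 ?expR_ge0 // exprn_ge0 // invr_ge0 ltW.
apply: (integral_of_bound v_homo v_unif (A := C)) => //.
- exact: CP.
- exact: g_vlip.
move=> x y sx xy yt.
have xT : x <= T by lra.
have vxy : 0 <= v y - v x by rewrite subr_ge0 v_homo //; lra.
apply: (le_trans (ler_wpM2r vxy (IHl _ s0 sx xT))).
rewrite /G exprS -!mulrA -mulrBr -mulrBr [leRHS]mulrCA.
rewrite ler_wpM2l ?exprn_ge0 ?invr_ge0 ?(ltW lam0) //.
rewrite -(ler_pM2l lam0) [leRHS]mulrA mulfV ?gt_eqF // mul1r.
have -> : lambda * (v y - v s) = lambda * (v x - v s) + lambda * (v y - v x) by ring.
rewrite expRD; set e := expR (lambda * (v x - v s)).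
have := ler_wpM2l (expR_ge0 (lambda * (v x - v s))) (expR_ge1Dx (lambda * (v y - v x))).
rewrite -/e; lra.
Qed.

Lemma vlipM A1 A2 M1 M2 f1 f2 a b :
  0 <= M1 -> 0 <= M2 ->
  vlip v A1 f1 a b -> vlip v A2 f2 a b ->
  (forall x, a <= x <= b -> `|f1 x| <= M1) -> (forall x, a <= x <= b -> `|f2 x| <= M2) ->
  vlip v (A1 * M2 + M1 * A2) (fun x => f1 x * f2 x) a b.
Proof.
move=> M10 M20 lip1 lip2 f1M f2M x y ax xy yb.
have -> : f1 y * f2 y - f1 x * f2 x = (f1 y - f1 x) * f2 y + f1 x * (f2 y - f2 x) by ring.
apply: le_trans (ler_normD _ _) _; rewrite !normrM mulrDl; apply: lerD.
  rewrite mulrAC; apply: ler_pM => //; first exact: lip1.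
  by apply: f2M; rewrite yb (le_trans ax xy).
rewrite -mulrA; apply: ler_pM => //; last exact: lip2.
by apply: f1M; rewrite ax (le_trans xy yb).
Qed.

(** With [h l y] for the inner integral on the right, [h (i :: l)] is shown to be a primitive of
    [h l] against [g i]. Its increment over [[x, y]] is the integral over [[s, x]] of [f u] times
    the increment of the signature from [u], which is [real_sig l u x * (g i y - g i x)] to the
    first order, plus an integral over [[x, y]] which is of second order because the signature of
    a nonempty word from [u] to [y] is small for [u] in [[x, y]]. *)
Lemma real_sig_fubini f A s t j i l : 0 <= s -> s <= t -> t <= T -> 0 <= A ->
  vlip v A f s t ->
  integral_of (fun u => f u * real_sig (i :: l) u t) (g j) s t =
  integral_of (fun y => integral_of (fun u => f u * real_sig l u y) (g j) s y) (g i) s t.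
Proof.
move=> s0 st tT A0 fA.
pose M := `|f s| + A * V.
have V0 : 0 <= V by have /andP[] := incr_bounds s0 st tT; apply: le_trans.
have M0 : 0 <= M by rewrite addr_ge0 ?mulr_ge0.
have fM x : s <= x <= t -> `|f x| <= M.
  move=> /andP[sx xt]; rewrite -(subrK (f s) (f x)) addrC.
  apply: le_trans (ler_normD _ _) _; rewrite lerD2l (le_trans (fA _ _ _ sx xt)) //.
  rewrite ler_wpM2l //; have /andP[] // := incr_bounds s0 sx (le_trans xt tT).
have kernel l' : exists2 C, 0 <= C & [/\
    forall u x y, s <= u -> u <= x -> x <= y -> y <= t ->
      `|real_sig l' u y| <= C /\ `|real_sig l' u y - real_sig l' u x| <= C * (v y - v x)
  & forall a b y, s <= a -> a <= b -> b <= y -> y <= t ->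
      has_RS_int (fun u => f u * real_sig l' u y) (g j) a b
        (integral_of (fun u => f u * real_sig l' u y) (g j) a b) /\
      integral_of (fun u => f u * real_sig l' u y) (g j) s b =
      integral_of (fun u => f u * real_sig l' u y) (g j) s a +
      integral_of (fun u => f u * real_sig l' u y) (g j) a b].
  have [C C0 CP] := real_sig_regular l'; exists C => //; split.
    move=> u x y su ux xy yt.
    by have [||//] := CP u x y _ ux xy; lra.
  move=> a b y sa ab b_y yt.
  have sb := le_trans sa ab; have s_y := le_trans sb b_y; have yT := le_trans yt tT.
  have bT := le_trans b_y yT.
  have lipy : vlip v (A * C + M * C) (fun u => f u * real_sig l' u y) s b.
    apply: vlipM => //.
    - by apply: vlipW fA => //; lra.
    - move=> x z sx xz zb.
      by have [||_ _ //] := CP x z y _ xz _ yT; lra.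
    - by move=> x /andP[sx xb]; apply: fM; rewrite sx; lra.
    - move=> x /andP[sx xb].
      by have [||//] := CP x x y _ (lexx x) _ yT; lra.
  have AC0 : 0 <= A * C + M * C by rewrite addr_ge0 ?mulr_ge0.
  split; last exact: (integral_of_chasles v_homo v_unif s0 sb bT AC0 lipy (g_vlip j s0 bT)).
  have a0 := le_trans s0 sa.
  apply: (has_integral_of v_homo v_unif a0 ab bT AC0); last exact: g_vlip.
  exact: vlipW lipy.
have [C C0 [C1 C2]] := kernel l; have [D D0 [D1 D2]] := kernel (i :: l).
have [E E0 EP] := real_sig_regular l.
pose h l' y := integral_of (fun u => f u * real_sig l' u y) (g j) s y.
have incr x y : s <= x -> x <= y -> y <= t -> 0 <= v y - v x <= V.
  by move=> sx xy yt; apply: incr_bounds => //; lra.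
rewrite -/(h l) -[LHS]/(h (i :: l) t) -[LHS]subr0.
have hs0 : h (i :: l) s = 0 by apply: integral_ofxx.
rewrite -hs0; apply/esym.
have hlip : vlip v (M * C * V + M * C) (h l) s t.
  move=> x y sx xy yt; have xt := le_trans xy yt; have sy := le_trans sx xy.
  have /andP[vxy0 vxyV] := incr _ _ sx xy yt.
  have /andP[vsx0 vsxV] := incr _ _ (lexx s) sx xt.
  have [h1 _] := C2 _ _ _ (lexx s) sx xy yt.
  have [h2 hy] := C2 _ _ _ sx xy (lexx y) yt.
  have [h3 _] := C2 _ _ _ (lexx s) sx (lexx x) xt.
  have {}h3 := has_RS_intD h1 (has_RS_intZ (-1) h3).
  have b2 : `|integral_of (fun u => f u * real_sig l u y) (g j) x y| <= M * C * (v y - v x).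
    apply: has_RS_int_le h2; rewrite ?(le_trans s0) ?(le_trans yt) //.
    move=> z /andP[xz zy]; rewrite normrM ler_pM ?fM ?(le_trans sx xz) ?(le_trans zy yt) //.
    by have [] := C1 _ _ _ (le_trans sx xz) zy (lexx y) yt.
  have b3 : `|integral_of (fun u => f u * real_sig l u y) (g j) s x +
      -1 * integral_of (fun u => f u * real_sig l u x) (g j) s x| <=
      M * (C * (v y - v x)) * (v x - v s).
    apply: has_RS_int_le h3; rewrite ?(le_trans xt) //.
    move=> z /andP[sz zx]; rewrite mulN1r -mulrBr normrM ler_pM ?fM ?sz ?(le_trans zx xt) //.
    by have [] := C1 _ _ _ sz zx xy yt.
  rewrite mulN1r in b3; rewrite /h hy addrAC.
  apply: le_trans (ler_normD _ _) _; apply: le_trans (lerD b3 b2) _.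
  rewrite [leRHS]mulrDl. apply: lerD; last by [].
  have -> : M * C * V * (v y - v x) = M * (C * (v y - v x)) * V by ring.
  by rewrite ler_wpM2l // !mulr_ge0.
apply: (integral_of_unique v_homo v_unif s0 st tT _ hlip (g_vlip i s0 tT)
  (C := M * E * V + M * D)).
- by rewrite addr_ge0 ?mulr_ge0.
- by rewrite addr_ge0 ?mulr_ge0.
move=> x y sx xy yt.
have xt := le_trans xy yt; have sy := le_trans sx xy; have yT := le_trans yt tT.
have /andP[vxy0 vxyV] := incr _ _ sx xy yt.
have /andP[vsx0 vsxV] := incr _ _ (lexx s) sx xt.
have [h1 _] := D2 _ _ _ (lexx s) sx xy yt.
have [h2 hy] := D2 _ _ _ sx xy (lexx y) yt.
have [h3 _] := D2 _ _ _ (lexx s) sx (lexx x) xt.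
have [h4 _] := C2 _ _ _ (lexx s) sx (lexx x) xt.
rewrite {1}/h hy.
have {}h3 := has_RS_intD (has_RS_intD h1 (has_RS_intZ (-1) h3))
  (has_RS_intZ (- (g i y - g i x)) h4).
have b2 : `|integral_of (fun u => f u * real_sig (i :: l) u y) (g j) x y| <=
    M * (D * (v y - v x)) * (v y - v x).
  apply: has_RS_int_le h2; rewrite ?(le_trans s0) //.
  move=> z /andP[xz zy]; rewrite normrM ler_pM ?fM ?(le_trans sx xz) ?(le_trans zy yt) //.
  have [_] := D1 _ _ _ (le_trans sx xz) (lexx z) zy yt.
  rewrite [real_sig _ z z]integral_ofxx subr0 => zD; apply: le_trans zD _.
  rewrite ler_wpM2l // lerD2l lerN2 v_homo // ?(le_trans zy) // ?(le_trans s0) //.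
have {}b3 : `|integral_of (fun u => f u * real_sig (i :: l) u y) (g j) s x +
    -1 * h (i :: l) x + - (g i y - g i x) * h l x| <=
    M * (E * (v y - v x) ^+ 2) * (v x - v s).
  apply: has_RS_int_le h3; rewrite ?(le_trans xt) //.
  move=> u /andP[su ux].
  have -> : f u * real_sig (i :: l) u y + -1 * (f u * real_sig (i :: l) u x) +
      - (g i y - g i x) * (f u * real_sig l u x) =
      f u * (real_sig (i :: l) u y - real_sig (i :: l) u x -
        real_sig l u x * (g i y - g i x)) by ring.
  have u0 := le_trans s0 su.
  rewrite normrM ler_pM ?fM ?su ?(le_trans ux xt) //.
  rewrite (real_sig_chasles i l u0 ux xy yT) [X in X - _]addrAC subrr add0r.
  have uT : u <= T by rewrite (le_trans ux) // (le_trans xy).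
  apply: (integral_of_local v_homo v_unif u0 uT (lexx T) E0) => //; last exact: g_vlip.
  by move=> z1 z2 uz z12 zT; have [] := EP _ _ _ u0 uz z12 zT.
have -> : integral_of (fun u => f u * real_sig (i :: l) u y) (g j) s x +
    integral_of (fun u => f u * real_sig (i :: l) u y) (g j) x y - h (i :: l) x -
    h l x * (g i y - g i x) =
    (integral_of (fun u => f u * real_sig (i :: l) u y) (g j) s x +
     -1 * h (i :: l) x + - (g i y - g i x) * h l x) +
    integral_of (fun u => f u * real_sig (i :: l) u y) (g j) x y by ring.
apply: le_trans (ler_normD _ _) _; apply: le_trans (lerD b3 b2) _.
rewrite [leRHS]mulrDl; apply: lerD; last by rewrite expr2 !mulrA.
have -> : M * E * V * (v y - v x) ^+ 2 = M * (E * (v y - v x) ^+ 2) * V by ring.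
by rewrite ler_wpM2l // !mulr_ge0 // sqr_ge0.
Qed.

(** The words are reversed, whence the order of [B] and [C]. *)
Lemma real_sig_concat B j C s t : 0 <= s -> s <= t -> t <= T ->
  has_RS_int (fun u => real_sig C s u * real_sig B u t) (g j) s t
    (real_sig (B ++ j :: C) s t).
Proof.
move=> s0 st tT.
have [D D0 DP] := real_sig_regular C; have [E E0 EP] := real_sig_regular B.
suff <- : integral_of (fun u => real_sig C s u * real_sig B u t) (g j) s t =
    real_sig (B ++ j :: C) s t.
  apply: (has_integral_of v_homo v_unif (A := D * E + D * E)) => //.
  - by rewrite addr_ge0 ?mulr_ge0.
  - apply: vlipM => // [x y sx xy yt|x y sx xy yt|x /andP[sx xt]|x /andP[sx xt]].
    + by have [] := DP s x y s0 sx xy (le_trans yt tT).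
    + by have [_ _] := EP x y t (le_trans s0 sx) xy yt tT.
    + by have [] := DP s x x s0 sx (lexx x) (le_trans xt tT).
    + by have [] := EP x x t (le_trans s0 sx) (lexx x) xt tT.
  - exact: g_vlip.
elim: B t st tT {E E0 EP} => [|i B IHB] t st tT /=.
  by apply: eq_integral_of => u _; rewrite mulr1.
rewrite (real_sig_fubini j i B s0 st tT D0); last first.
  by move=> x y sx xy yt; have [] := DP s x y s0 sx xy (le_trans yt tT).
apply: eq_integral_of => u /andP[su ut]; apply: IHB => //; exact: le_trans tT.
Qed.

End Signature.

(** * A control for a continuous path of bounded variation *)

Section PathControl.
Variables (R : realType).

(** Uniform continuity, by compactness of [[0, T]]. *)
Lemma continuous_modulus (T e : R) (v : R -> R) : 0 < e ->
  {within `[0, T], continuous v} ->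
  exists2 delta, 0 < delta &
    forall x y, 0 <= x -> x <= y -> y <= T -> y - x < delta -> v y - v x < e.
Proof.
move=> e0 /subspace_continuousP vc.
have e20 : 0 < e / 2 by rewrite divr_gt0.
have /compact_near_coveringP/near_covering_withinP cov := @segment_compact R 0 T.
have : \forall delta \near 0^'+, `[0, T] `<=`
    (fun x => forall y, x <= y -> y <= T -> y - x < delta -> v y - v x < e).
  apply: cov => x xT; have /cvgrPdist_lt/(_ _ e20) := vc _ xT.
  rewrite near_withinE => /nbhs_ballP[r /= r0 vr].
  have r20 : 0 < r / 2 by rewrite divr_gt0.
  exists (ball x (r / 2), [set delta | delta < r / 2]).
    by split; [exact: nbhsx_ballx|exact: nbhs_right_lt].
  move=> [x' delta] /= [xx' dr] x'T y x'y yT yx'.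
  have h z : z \in `[0, T] -> `|x - z| < r -> `|v x - v z| < e / 2.
    by move=> zT xz; apply: vr => //; rewrite inE in zT.
  move: x'T; rewrite in_itv /= => /andP[x'0 x'T].
  have h1 : `|v x - v x'| < e / 2.
    by apply: h; [rewrite in_itv /= x'0|move: xx'; rewrite /ball /=; lra].
  have h2 : `|v x - v y| < e / 2.
    apply: h; first by rewrite in_itv /= yT (le_trans x'0).
    by move: xx'; rewrite /ball /= !ltr_norml; lra.
  by move: h1 h2; rewrite !ltr_norml; lra.
move=> H; have [delta [/= d0 dH]] : exists delta, 0 < delta /\ `[0, T] `<=`
    (fun x => forall y, x <= y -> y <= T -> y - x < delta -> v y - v x < e).
  have : \forall delta \near 0^'+, 0 < delta /\ `[0, T] `<=`
    (fun x => forall y, x <= y -> y <= T -> y - x < delta -> v y - v x < e).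
    by near=> delta; split; near: delta => //; exact: nbhs_right_gt.
  exact: filter_ex.
exists delta => // x y x0 xy yT; apply: dH => //=.
by rewrite in_itv /= x0 (le_trans xy).
Unshelve. all: by end_near. Qed.

Lemma le_coord_norm d (x : 'rV[R]_d) j : `|x 0 j| <= `|x|.
Proof.
rewrite [leRHS]/Num.Def.normr /= mx_normrE.
by rewrite (le_bigmax _ (fun ij : 'I_1 * 'I_d => `|x ij.1 ij.2|) (0, j)).
Qed.

Lemma bounded_variation_coord d (T : R) (X : R -> 'rV[R]_d) j :
  path_bounded_variation 0 T X -> bounded_variation 0 T (Defs.coord X j).
Proof.
move=> [M Mub]; exists M => _ [s abs <-].
apply: le_trans (Mub _ (ex_intro2 _ _ s abs erefl)).
rewrite /variation big_mkord; apply: ler_sum => k _.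
have nthE i : (i <= size s)%N -> nth T (0 :: s) i = nth 0 (0 :: s) i.
  by move=> si; apply: set_nth_default.
rewrite /comp (nthE k.+1) // (nthE k); last exact: ltnW.
have := le_coord_norm (X (nth 0 (0 :: s) k.+1) - X (nth 0 (0 :: s) k)) j.
by rewrite !mxE.
Qed.

(** The sum of the total variations of the coordinates. It is continuous because the path is. *)
Lemma path_control d (T : R) (X : R -> 'rV[R]_d) : 0 <= T ->
  {within `[0, T], continuous X} -> path_bounded_variation 0 T X ->
  exists v : R -> R, [/\
    forall x y, 0 <= x -> x <= y -> y <= T -> v x <= v y,
    forall e, 0 < e -> exists2 delta, 0 < delta &
      forall x y, 0 <= x -> x <= y -> y <= T -> y - x < delta -> v y - v x < e
  & forall j, vlip v 1 (Defs.coord X j) 0 T].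
Proof.
rewrite le_eqVlt => /predU1P[<- _ _|T0 Xc Xbv].
  exists (fun=> 0); split=> // [e e0|j x y x0 xy y0].
    by exists 1 => // *; rewrite subrr.
  have -> : x = 0 by apply/eqP; rewrite eq_le x0 (le_trans xy).
  have -> : y = 0 by apply/eqP; rewrite eq_le y0 (le_trans x0).
  by rewrite !subrr mulr0 normr0.
pose tv j x := fine (total_variation 0 x (Defs.coord X j)).
have bv j := bounded_variation_coord j Xbv.
have tv_incr j x y : 0 <= x -> x <= y -> y <= T ->
    `|Defs.coord X j y - Defs.coord X j x| <= tv j y - tv j x.
  move=> x0 xy yT; have y0 := le_trans x0 xy; have xT := le_trans xy yT.
  have fx : total_variation 0 x (Defs.coord X j) \is a fin_num.
    by apply/bounded_variationP => //; apply: bounded_variationl (bv j).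
  have bxy : bounded_variation x y (Defs.coord X j).
    by apply: (bounded_variationr x0 xy); apply: bounded_variationl (bv j).
  have fxy := (bounded_variationP _ xy).1 bxy.
  rewrite /tv (total_variationD _ x0 xy) fineD // addrAC subrr add0r.
  by rewrite -lee_fin fineK // total_variation_ge.
exists (fun x => \sum_j tv j x); split.
- move=> x y x0 xy yT; apply: ler_sum => j _; rewrite -subr_ge0.
  exact: le_trans (tv_incr j _ _ x0 xy yT).
- move=> e e0; apply: continuous_modulus => //.
  have tvc j : {within `[0, T], continuous (tv j)}.
    apply: total_variation_continuous => //.
    apply/subspace_continuousP => x xT; move/subspace_continuousP: Xc => /(_ x xT) Xx.
    exact: (cvg_comp _ _ Xx (@coord_continuous _ _ _ 0 j (X x))).
  have sumc (r : seq 'I_d) : {within `[0, T], continuous (fun x => \sum_(j <- r) tv j x)}.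
    apply/subspace_continuousP => x xT; elim: r => [|j r IHr].
      have -> : (fun x => \sum_(j <- [::]) tv j x) = fun=> 0.
        by apply/funext => y; rewrite big_nil.
      exact: cvg_cst.
    have -> : (fun x => \sum_(k <- j :: r) tv k x) =
        (fun x => tv j x + \sum_(k <- r) tv k x).
      by apply/funext => y; rewrite big_cons.
    apply: cvgD IHr.
    by move/subspace_continuousP: (tvc j) => /(_ x xT).
  exact: sumc.
- move=> j x y x0 xy yT; rewrite mul1r -sumrB (bigD1 j) //=.
  rewrite (le_trans (tv_incr j _ _ x0 xy yT)) // lerDl sumr_ge0 // => i _.
  exact: le_trans (tv_incr i _ _ x0 xy yT).
Qed.

End PathControl.

(** * Expansion of the iterated integrals of the kernel over words *)

Section Limits.
Variable R : realType.

(** The limit is the supremum of [u n - 2 * C * 2^-1 ^+ n], which increases, while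
    [u n + 2 * C * 2^-1 ^+ n] decreases. *)
Lemma geometric_limit (u : nat -> R) C :
  (forall n, `|u n.+1 - u n| <= C * 2^-1 ^+ n) ->
  exists w, forall n, `|u n - w| <= 2 * C * 2^-1 ^+ n.
Proof.
move=> uC; pose h n : R := 2^-1 ^+ n.
have h0 n : 0 <= h n by rewrite exprn_ge0.
have hS n : h n.+1 = h n / 2 by rewrite /h exprSr.
have C0 : 0 <= C by have := uC 0; rewrite expr0 mulr1; apply: le_trans.
pose a n := u n - 2 * C * h n; pose b n := u n + 2 * C * h n.
have step n : a n <= a n.+1 /\ b n.+1 <= b n.
  have := uC n; rewrite ler_norml -/(h n) /a /b hS => /andP[l1 l2].
  by split; lra.
have a_homo m n : (m <= n)%N -> a m <= a n.
  by move=> mn; apply: (homo_leq (f := a) (r := <=%R)) => // [x y z|k];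
    [exact: le_trans|have [] := step k].
have b_homo m n : (m <= n)%N -> b n <= b m.
  move=> mn; apply: (homo_leq (f := b) (r := fun x y => y <= x)) => // [x y z yx zy|k];
    [exact: le_trans zy yx|by have [] := step k].
have ab m n : a m <= b n.
  apply: le_trans (a_homo _ _ (leq_maxl m n)) _.
  apply: le_trans (b_homo _ _ (leq_maxr m n)).
  by rewrite /a /b lerD2l; have := mulr_ge0 C0 (h0 (maxn m n)); lra.
have ubb n : ubound (range a) (b n) by move=> _ [m _ <-].
have ub : has_ubound (range a) by exists (b 0).
exists (sup (range a)) => n; rewrite -/(h n).
have l1 : a n <= sup (range a) by apply: ub_le_sup => //; exists n.
have l2 : sup (range a) <= b n.
  by apply: ge_sup; [exists (a 0), 0|exact: ubb].
by move: l1 l2; rewrite /a /b ler_norml; lra.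
Qed.

(** Everything here is real: the complex limit is reduced to a limit of real numbers with an
    explicit rate. *)
Lemma word_sum_eq d (x : seq 'I_d -> R) C w :
  (forall n, `|\sum_(k < n) level_sum k x - w| <= C * 2^-1 ^+ n) ->
  word_sum (fun W => (x (rev W))%:C%C) = w%:C%C.
Proof.
move=> xC; rewrite /word_sum.
have -> : series (fun n => \sum_(W : n.-tuple 'I_d) (x (rev W))%:C%C) =
    (fun n => (\sum_(k < n) level_sum k x)%:C%C) :> (nat -> R[i]^o).
  apply/funext => n; rewrite /series /= big_mkord rmorph_sum; apply: eq_bigr => k _.
  by rewrite -level_sum_rev rmorph_sum.
apply: (@cvg_lim R[i]^o (@norm_hausdorff _ R[i]^o) nat \oo _
  (fun n : nat => (\sum_(k < n) level_sum k x)%:C%C) w%:C%C).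
apply/cvgrPdist_lt => e e0.
have [e1 e1E] : exists e1, e = e1%:C%C.
  by apply/complex_realP; rewrite ger0_real // ltW.
rewrite e1E ltcR in e0; rewrite e1E.
have C0 : 0 <= C by have := xC 0; rewrite expr0 mulr1; apply: le_trans.
near=> n; rewrite -rmorphB normc_def /= expr0n /= addr0 sqrtr_sqr ltcR distrC.
apply: le_lt_trans (xC n) _.
rewrite exprVn ltr_pdivrMr ?exprn_gt0 // [ltRHS]mulrC -ltr_pdivrMr //.
apply: (@lt_trans _ _ n%:R); last by rewrite -natrX ltr_nat ltn_expl.
apply: lt_le_trans (archi_boundP _) _; first by rewrite divr_ge0 // ltW.
by rewrite ler_nat; near: n; exact: nbhs_infty_ge.
Unshelve. all: by end_near. Qed.

(** The finite sum over matchings keeps the geometric rate of each of its terms. *)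
Lemma sum_rate (I : Type) (r : seq I) (a : I -> R) (u : I -> nat -> R) (w : I -> R) :
  (forall i, exists C, forall n, `|u i n - w i| <= C * 2^-1 ^+ n) ->
  exists C, forall n, `|\sum_(i <- r) a i * u i n - \sum_(i <- r) a i * w i| <=
    C * 2^-1 ^+ n.
Proof.
move=> uC; elim: r => [|i r [C1 C1P]].
  by exists 0 => n; rewrite !big_nil subrr normr0 mul0r.
have [C2 C2P] := uC i; exists (`|a i| * C2 + C1) => n.
rewrite !big_cons opprD addrACA -mulrBr; apply: le_trans (ler_normD _ _) _.
by rewrite normrM mulrDl -mulrA lerD // ler_wpM2l.
Qed.

End Limits.

Section Chains.
Variables (R : realType) (d : nat) (X : R -> 'rV[R]_d).

Lemma K_chain_rcons s t us u :
  K_chain X s t (rcons us u) = K_chain X s u us * Defs.K X u t.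
Proof. by elim: us s => [|w us IHus] s //=; rewrite IHus mulrA. Qed.

Lemma iter_int_revMr l (F : seq R -> R[i]) c s t : s <= t ->
  iter_int_rev X l (fun us => F us * c) s t = iter_int_rev X l F s t * c.
Proof.
elim: l F t => [|j l IHl] F t st //=.
rewrite -RS_intMr //; apply: eq_RS_int => u /andP[su _].
exact: (IHl (fun us => F (rcons us u))).
Qed.

(** The last kernel of the chain depends on the outermost variable only, and comes out of
    the inner integrals as a constant. *)
Lemma K_int_rcons J j s t : s <= t ->
  K_int X (rcons J j) s t =
  - RS_int (fun u => K_int X J s u * Defs.K X u t) (Defs.coord X j) s t.
Proof.
move=> st; rewrite /K_int /iter_int size_rcons rev_rcons /= exprS mulN1r mulNr; congr (- _).
rewrite mulrC -RS_intMr //; apply: eq_RS_int => u /andP[su _].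
rewrite -mulrA [RHS]mulrC -mulrA; under eq_fun do rewrite K_chain_rcons.
by rewrite iter_int_revMr // mulrA.
Qed.

End Chains.
(** Summing by diagonals. *)
Lemma sum_triangle (A : comNzRingType) (D : nat -> nat -> A) N :
  \sum_(n < N) \sum_(p < n.+1) D p (n - p)%N =
  \sum_(p < N) \sum_(r < N) if (p + r < N)%N then D p r else 0.
Proof.
have H (n : 'I_N) : \sum_(p < n.+1) D p (n - p)%N =
    \sum_(p < N) \sum_(r < N) if (p + r == n)%N then D p r else 0.
  rewrite (big_ord_widen N (fun p => D p (n - p)%N)) // big_mkcond /=.
  apply: eq_bigr => p _; rewrite -big_mkcond /=.
  case: ltnP => [pn|np]; last by rewrite big_pred0 // => r; lia.
  have rN : (n - p < N)%N by rewrite (leq_ltn_trans (leq_subr _ _)).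
  by rewrite (big_pred1 (Ordinal rN)) // => r; rewrite /= -val_eqE /=; lia.
under eq_bigr => n _ do rewrite H.
rewrite exchange_big; apply: eq_bigr => p _; rewrite exchange_big; apply: eq_bigr => r _ /=.
rewrite -big_mkcond /=; case: ltnP => [prN|Npr].
  by rewrite (big_pred1 (Ordinal prN)) // => n; rewrite /= -val_eqE /= eq_sym.
by rewrite big_pred0 // => n; have := ltn_ord n; lia.
Qed.

Section Expansion.
Variables (R : realType) (d : nat) (T : R) (X : R -> 'rV[R]_d) (v : R -> R).

Hypothesis v_homo : forall x y, 0 <= x -> x <= y -> y <= T -> v x <= v y.
Hypothesis v_unif : forall e, 0 < e -> exists2 delta, 0 < delta &
  forall x y, 0 <= x -> x <= y -> y <= T -> y - x < delta -> v y - v x < e.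
Hypothesis g_lip : forall j, vlip v 1 (Defs.coord X j) 0 T.

Local Notation sig := (real_sig (Defs.coord X)).
Local Notation coef := (stack_count (- 1 : R)).

Lemma signatureE W s t : 0 <= s -> s <= t -> t <= T ->
  signature X W s t = (sig (rev W) s t)%:C%C.
Proof.
rewrite /signature /iter_int; move: (rev W) => l s0.
elim: l t => [|j l IHl] t st tT //=.
rewrite (@eq_RS_int _ _ (fun u => (sig l s u)%:C%C)).
  have [C C0 CP] := real_sig_vlip v_homo v_unif g_lip l.
  apply: (integral_ofC v_homo v_unif s0 st tT C0); first exact: CP.
  exact: (g_vlip g_lip).
by move=> u /andP[su ut]; apply: IHl => //; exact: le_trans tT.
Qed.

Lemma phi_weight (W : seq 'I_d) :
  'i ^+ size W * (phi W)%:R = (coef (rev W) [::])%:C%C :> R[i].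
Proof.
rewrite (phi_stack_count W R[i]) -(size_rev W) -[size (rev W)]addn0.
rewrite -[0%N]/(size (Nil 'I_d)) stack_count_scale sqrCi mulr1.
by rewrite (rmorph_stack_count (real_complex R)) rmorphN1.
Qed.

(** The number of words of length [n] is [d ^ n] and their coefficients are at most [2 ^ n], so
    that a decay of the signature at rate [mu] makes the level of length [n] of order [8 ^ - n].
    The rate [8] leaves room for the [n ^ 2] terms in the comparison of a square with a triangle
    in [K_int_expansion]; the successor of [d] avoids a division by zero. *)
Let mu : R := (16 * d.+1%:R)^-1.

Lemma mu_ge0 : 0 <= mu.
Proof. by rewrite invr_ge0 mulr_ge0. Qed.

Lemma sig_decay : exists2 E, 0 <= E & forall l s t, 0 <= s -> s <= t -> t <= T ->
  `|sig l s t| <= E * mu ^+ size l.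
Proof.
have lam0 : 0 < 16 * d.+1%:R :> R by rewrite mulr_gt0.
exists (expR (16 * d.+1%:R * (v T - v 0))) => [|l s t s0 st tT]; first exact: expR_ge0.
apply: le_trans (real_sig_exp_bound v_homo v_unif g_lip l lam0 s0 st tT) _.
rewrite mulrC ler_wpM2r ?exprn_ge0 ?mu_ge0 // ler_expR ler_wpM2l ?(ltW lam0) //.
by have /andP[] := incr_bounds v_homo s0 st tT.
Qed.

Lemma level_rate n : d%:R ^+ n * (2 ^+ n * mu ^+ n) <= 8^-1 ^+ n.
Proof.
rewrite -!exprMn; apply: lerXn2r; rewrite ?nnegrE ?mulr_ge0 ?mu_ge0 ?invr_ge0 //.
rewrite /mu mulrA ler_pdivrMr ?mulr_gt0 // -natr1 mulrDr; lra.
Qed.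

(** The stack [J] is listed from its top, so that it is the reversal of the word along which the
    kernel is integrated. *)
Definition level J n s t := level_sum n (fun l => coef l J * sig l s t).
Definition partial_sum J n s t := \sum_(k < n) level J k s t.

Lemma level_bound : exists2 E, 0 <= E & forall J n s t, 0 <= s -> s <= t -> t <= T ->
  `|level J n s t| <= E * 8^-1 ^+ n.
Proof.
have [E E0 EP] := sig_decay; exists E => // J n s t s0 st tT.
apply: (@le_trans _ _ (d%:R ^+ n * (2 ^+ n * (E * mu ^+ n)))).
  rewrite -{1}(card_ord d); apply: norm_level_sum => l ln.
  by rewrite normrM ler_pM // -ln ?EP // norm_stack_count.
by rewrite [2 ^+ n * _]mulrCA [leLHS]mulrCA ler_wpM2l // level_rate.
Qed.

Lemma partial_sum_limit : exists2 C, 0 <= C & forall J s t, 0 <= s -> s <= t -> t <= T ->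
  exists w, forall n, `|partial_sum J n s t - w| <= C * 2^-1 ^+ n.
Proof.
have [E E0 EP] := level_bound; exists (2 * E) => [|J s t s0 st tT].
  by rewrite mulr_ge0.
apply: geometric_limit => n; rewrite /partial_sum big_ord_recr /= addrAC subrr add0r.
apply: le_trans (EP _ _ _ _ s0 st tT) _; rewrite ler_wpM2l //.
by apply: lerXn2r; rewrite ?nnegrE ?invr_ge0 //; lra.
Qed.

(** The contribution of the words of length [p] and [r] to the integral of the product of two
    expansions. The factor [B] is the one read first by the stack; it comes from the kernel
    between [u] and [t]. *)
Definition product_level j J s t p r :=
  level_sum p (fun B => level_sum r (fun C =>
    coef B [::] * coef C J * sig (B ++ j :: C) s t)).

Lemma product_level_bound : exists2 E, 0 <= E & forall j J s t p r,
  0 <= s -> s <= t -> t <= T ->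
  `|product_level j J s t p r| <= E * 8^-1 ^+ (p + r).
Proof.
have [E E0 EP] := sig_decay; exists E => // j J s t p r s0 st tT.
apply: (@le_trans _ _ (d%:R ^+ p * (d%:R ^+ r * (2 ^+ p * 2 ^+ r * (E * mu ^+ (p + r)))))).
  rewrite -{1 2}(card_ord d); apply: norm_level_sum => B Bp; apply: norm_level_sum => C Cr.
  rewrite normrM ler_pM //.
    by rewrite normrM ler_pM // -?Bp -?Cr norm_stack_count.
  apply: le_trans (EP _ _ _ s0 st tT) _; rewrite ler_wpM2l //.
  rewrite size_cat /= Bp Cr addnS exprS ler_piMl ?exprn_ge0 ?mu_ge0 //.
  rewrite invf_le1 ?mulr_gt0 //; have : 1 <= d.+1%:R :> R by rewrite ler1n.
  lra.
have -> : d%:R ^+ p * (d%:R ^+ r * (2 ^+ p * 2 ^+ r * (E * mu ^+ (p + r)))) =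
    E * (d%:R ^+ (p + r) * (2 ^+ (p + r) * mu ^+ (p + r))) by rewrite !exprD; ring.
by rewrite ler_wpM2l // level_rate.
Qed.

(** The product formula [stack_count_split] for the coefficients meets the concatenation formula
    for the signatures. The partial sum contains the words of length at most [N], one letter of
    which is [j]. *)
Lemma partial_sum_product j J s t N :
  partial_sum (j :: J) N.+1 s t =
  - \sum_(p < N) \sum_(r < N)
      if (p + r < N)%N then product_level j J s t p r else 0.
Proof.
rewrite -sum_triangle /partial_sum big_ord_recl {1}/level /= mul0r add0r -sumrN.
apply: eq_bigr => n _; rewrite /level (_ : bump 0 n = n.+1) //.
under eq_level_sum => l _.
  rewrite (stack_count_split _ _ [::]) mulN1r mulNr.
  rewrite (split_sum_mulr _ _ (fun l => sig l s t)) -mulN1r; over.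
by rewrite level_sumZ mulN1r level_sum_split.
Qed.

Lemma has_RS_int_partial_sums j J s t N : 0 <= s -> s <= t -> t <= T ->
  has_RS_int (fun u => partial_sum J N s u * partial_sum [::] N u t) (Defs.coord X j) s t
    (\sum_(p < N) \sum_(r < N) product_level j J s t p r).
Proof.
move=> s0 st tT.
have H p r : has_RS_int (fun u => level_sum p (fun B => level_sum r (fun C =>
    coef B [::] * coef C J * (sig C s u * sig B u t)))) (Defs.coord X j) s t
    (product_level j J s t p r).
  apply: has_RS_int_level_sum => B; apply: has_RS_int_level_sum => C.
  exact: has_RS_intZ (real_sig_concat v_homo v_unif g_lip B j C s0 st tT).
apply: eq_has_RS_int (has_RS_int_sum N (fun p => has_RS_int_sum N (H p))) => u _.
rewrite mulrC /partial_sum mulr_suml; apply: eq_bigr => p _.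
rewrite mulr_sumr; apply: eq_bigr => r _.
rewrite /level mulrC -level_sumZ; apply: eq_level_sum => B _.
rewrite mulrC -level_sumZ; apply: eq_level_sum => C _; ring.
Qed.

Definition K_int_real J s t : R := complex.Re (K_int X (rev J) s t).

(** By induction on the word. The integrand is the uniform limit of the products of two partial
    sums. The integral of such a product is a sum over a square of pairs of lengths, whereas the
    partial sum for the longer word is, up to the sign, the sum over the triangle below the
    diagonal ([partial_sum_product]); the difference tends to [0]. The constant is uniform in [s]
    and [t], as required by the integration over the intermediate time in the next step. *)
Lemma K_int_expansion J : exists2 C, 0 <= C & forall s t, 0 <= s -> s <= t -> t <= T ->
  K_int X (rev J) s t = (K_int_real J s t)%:C%C /\
  forall n, `|partial_sum J n s t - K_int_real J s t| <= C * 2^-1 ^+ n.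
Proof.
have [C C0 CP] := partial_sum_limit.
suff H J' : exists2 C', 0 <= C' & forall s t, 0 <= s -> s <= t -> t <= T -> exists w : R,
    K_int X (rev J') s t = w%:C%C /\
    forall n, `|partial_sum J' n s t - w| <= C' * 2^-1 ^+ n.
  have [C' C'0 HC] := H J; exists C' => // s t s0 st tT.
  by have [w [KE wP]] := HC _ _ s0 st tT; rewrite /K_int_real KE.
have base s t : 0 <= s -> s <= t -> t <= T -> exists w : R,
    Defs.K X s t = w%:C%C /\ forall n, `|partial_sum [::] n s t - w| <= C * 2^-1 ^+ n.
  move=> s0 st tT; have [w wP] := CP [::] s t s0 st tT; exists w; split=> //.
  rewrite -(word_sum_eq wP); congr word_sum; apply/funext => W.
  by rewrite phi_weight signatureE // rmorphM.
elim: J' => [|j J' [C1 C10 IH]].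
  by exists C => // s t s0 st tT; rewrite K_int_nil; exact: base.
exists C => // s t s0 st tT; have [w wP] := CP (j :: J') s t s0 st tT.
exists w; split=> //.
pose k u := complex.Re (K_int X (rev J') s u).
pose k0 u := complex.Re (Defs.K X u t).
have kP u : s <= u -> u <= T -> K_int X (rev J') s u = (k u)%:C%C /\
    forall n, `|partial_sum J' n s u - k u| <= C1 * 2^-1 ^+ n.
  by move=> su uT; have [w1 [E wP1]] := IH _ _ s0 su uT; rewrite /k E.
have k0P u : s <= u -> u <= t -> Defs.K X u t = (k0 u)%:C%C /\
    forall n, `|partial_sum [::] n u t - k0 u| <= C * 2^-1 ^+ n.
  by move=> su ut; have [w1 [E wP1]] := base _ _ (le_trans s0 su) ut tT; rewrite /k0 E.
rewrite rev_cons K_int_rcons //.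
rewrite (@eq_RS_int _ _ (fun u => (k u * k0 u)%:C%C)); last first.
  move=> u /andP[su ut]; rewrite rmorphM.
  by rewrite (kP _ su (le_trans ut tT)).1 (k0P _ su ut).1.
have [E E0 EP] := product_level_bound.
suff h : has_RS_int (fun u => k u * k0 u) (Defs.coord X j) s t (- w).
  by rewrite (real_RS_intE st h) rmorphN opprK.
apply: (has_RS_int_limit v_homo g_lip (C := 3 * C1 * C + E + C)) => //.
  by rewrite !addr_ge0 ?mulr_ge0.
move=> n; exists (fun u => partial_sum J' n s u * partial_sum [::] n u t).
exists (\sum_(p < n) \sum_(r < n) product_level j J' s t p r).
pose h : R := 2^-1 ^+ n.
have h0 : 0 <= h by rewrite exprn_ge0.
have h1 : h <= 1 by apply: exprn_ile1; lra.
split; first exact: has_RS_int_partial_sums.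
- move=> u /andP[su ut]; rewrite -/h.
  have [_ kn] := kP _ su (le_trans ut tT); have [_ k0n] := k0P _ su ut.
  have kb : `|k u| <= C1.
    by have := kn 0; rewrite expr0 mulr1 /partial_sum big_ord0 sub0r normrN.
  have k0b : `|k0 u| <= C.
    by have := k0n 0; rewrite expr0 mulr1 /partial_sum big_ord0 sub0r normrN.
  have Q : `|partial_sum [::] n u t| <= 2 * C.
    rewrite -(subrK (k0 u) (partial_sum _ _ _ _)); apply: le_trans (ler_normD _ _) _.
    have := k0n n; have : C * h <= C by rewrite ler_piMr.
    rewrite -/h; lra.
  have -> : k u * k0 u - partial_sum J' n s u * partial_sum [::] n u t =
    - ((partial_sum J' n s u - k u) * partial_sum [::] n u t +
       k u * (partial_sum [::] n u t - k0 u)) by ring.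
  rewrite normrN; apply: le_trans (ler_normD _ _) _; rewrite !normrM.
  have t1 := ler_pM (normr_ge0 _) (normr_ge0 _) (kn n) Q.
  have t2 := ler_pM (normr_ge0 _) (normr_ge0 _) kb (k0n n).
  apply: le_trans (lerD t1 t2) _; rewrite -/h.
  have : 0 <= (E + C) * h by rewrite mulr_ge0 // addr_ge0.
  have -> : (3 * C1 * C + E + C) * h = 3 * C1 * C * h + (E + C) * h by ring.
  have -> : C1 * h * (2 * C) + C1 * (C * h) = 3 * C1 * C * h by ring.
  lra.
- rewrite opprK -/h.
  have t1 : `|\sum_(p < n) \sum_(r < n) product_level j J' s t p r +
      partial_sum (j :: J') n.+1 s t| <= E * h.
    rewrite partial_sum_product -sumrB.
    apply: (@le_trans _ _ (\sum_(p < n) \sum_(r < n) E * 8^-1 ^+ n)).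
      apply: (le_trans (ler_norm_sum _ _ _)); apply: ler_sum => p _.
      rewrite -sumrB; apply: (le_trans (ler_norm_sum _ _ _)); apply: ler_sum => r _.
      case: ltnP => [prn|npr].
        by rewrite subrr normr0 mulr_ge0 // exprn_ge0 // invr_ge0.
      rewrite subr0; apply: le_trans (EP _ _ _ _ _ _ s0 st tT) _.
      by rewrite ler_wpM2l //; apply: ler_wiXn2l => //; lra.
    rewrite sumr_const card_ord -[leLHS]mulr_natl sumr_const card_ord.
    rewrite -[X in _ * X]mulr_natl.
    (* Two of the three factors [h] absorb the at most [n ^ 2] terms above the diagonal. *)
    have -> : 8^-1 = 2^-1 * (2^-1 * 2^-1) :> R by field.
    rewrite !exprMn -/h.
    have n2 : n%:R <= 2 ^+ n :> R by rewrite -natrX ler_nat ltnW // ltn_expl.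
    have nh : n%:R * h <= 1.
      by rewrite /h exprVn ler_pdivrMr ?exprn_gt0 // mul1r.
    have nh0 : 0 <= n%:R * h by rewrite mulr_ge0.
    have -> : n%:R * (n%:R * (E * (h * (h * h)))) = E * h * (n%:R * h * (n%:R * h)) by ring.
    by rewrite ler_piMr ?mulr_ge0 // mulr_ile1.
  have := wP n.+1; rewrite exprSr -/h => t2.
  have t3 : C * (h / 2) <= C * h by rewrite ler_wpM2l //; lra.
  have t4 : 0 <= 3 * C1 * C * h by rewrite !mulr_ge0.
  have -> : (3 * C1 * C + E + C) * h = 3 * C1 * C * h + E * h + C * h by ring.
  by move: t1 t2; rewrite !ler_norml; lra.
Qed.

End Expansion.

Theorem proposition23 (R : realType) (d : nat) (T p : R) (X : R -> 'rV[R]_d)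
    (X_cont : {within `[0, T], continuous X})
    (X_bv : path_bounded_variation 0 T X)
    (p_ge1 : 1 <= p)
    (I : seq 'I_d) (I_neq0 : I != [::])
    (I_le : (size I)%:Z <= Num.floor p - 1)
    (s t : R) (s_ge0 : 0 <= s) (s_le_t : s <= t) (t_le_T : t <= T) :
  K_component X I s t =
    \sum_(pi <- NC (size I))
      (\prod_(ab <- matched_pairs (size I) pi)
          ((- 1) * (letter I ab.1 == letter I ab.2)%:R)) *
      K_int X (subword I (unmatched (size I) pi)) s t.
Proof.
have T0 : 0 <= T := le_trans s_ge0 (le_trans s_le_t t_le_T).
have [v [v_homo v_unif g_lip]] := path_control T0 X_cont X_bv.
pose J pi := rev (unmatched_word I pi).
have expansion pi := K_int_expansion v_homo v_unif g_lip (J pi).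
have [C CP] := sum_rate (NC (size I)) (matching_weight R I)
  (u := fun pi n => partial_sum X (J pi) n s t)
  (w := fun pi => K_int_real X (J pi) s t)
  (fun pi => let: ex_intro2 C _ CP := expansion pi in
     ex_intro _ C (CP s t s_ge0 s_le_t t_le_T).2).
transitivity ((\sum_(pi <- NC (size I))
    matching_weight R I pi * K_int_real X (J pi) s t)%:C%C : R[i]); last first.
  rewrite rmorph_sum; apply: eq_bigr => pi _; rewrite rmorphM rmorph_prod; congr (_ * _).
    by apply: eq_bigr => ab _; rewrite rmorphM rmorphN1 rmorph_nat.
  have [C1 _ C1P] := expansion pi.
  have [KE _] := C1P s t s_ge0 s_le_t t_le_T; rewrite revK in KE.
  exact: esym KE.
(* The total coefficient of the reversed word [l]: the stack reads [I] before [l]. *)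
pose x l := stack_count (- 1 : R) (I ++ l) [::] * real_sig (Defs.coord X) l s t.
have xE k : level_sum k x =
    \sum_(pi <- NC (size I)) matching_weight R I pi * level X (J pi) k s t.
  rewrite -level_sum_linear; apply: eq_level_sum => l _.
  rewrite /x -NC_sum_stack_count mulr_suml; apply: eq_bigr => pi _.
  by rewrite mulrA.
have xC n : `|\sum_(k < n) level_sum k x - \sum_(pi <- NC (size I))
    matching_weight R I pi * K_int_real X (J pi) s t| <= C * 2^-1 ^+ n.
  under eq_bigr do rewrite xE.
  rewrite exchange_big /=; under eq_bigr do rewrite -mulr_sumr.
  exact: CP.
rewrite -(word_sum_eq xC); congr word_sum; apply/funext => W.
have -> : (size W + size I)%N = size (W ++ rev I) by rewrite size_cat size_rev.
rewrite phi_weight rev_cat revK (signatureE v_homo v_unif g_lip) //.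
by rewrite -rmorphM.
Qed.
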